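(* There exist universal constants $c'>0$ and $\varepsilon'>0$ such that the following holds. Let $D$ be a domain in the unit ball $\mathbb{B}^{2n}$ equipped with an almost complex structure $J$, and let $u$ be a negative function of class $\mathcal{C}^2$ on $\bar{D}$, strictly $J$-plurisubharmonic on $D$. If $\|J-J_{st}\|_{\mathcal{C}^1(\bar{D})}\le\varepsilon'$, then $$\forall p\in D,\ \forall v\in\mathbb{R}^{2n},\quad K_{(D,J)}(p,v)\ge c'\,e^{-2t}\,\sqrt{\lambda_0(D,J,u)}\,\frac{\|v\|}{\sqrt{|u(p)|}}$$ as soon as $D$ is bounded by $t$.
   Context: $\mathbb{B}^{2n}$ is the unit ball of $\mathbb{R}^{2n}$, $\Delta\subset\mathbb{C}$ the open unit disc, $\|\cdot\|$ the Euclidean norm, $J_{st}=\begin{pmatrix}0&-I_n\\ I_n&0\end{pmatrix}$. ''$D$ is bounded by $t$'' means $\|x\|\le t$ for all $x\in D$. An almost complex structure on $D$ is a map $J$ from $D$ (here $\mathcal{C}^1$ up to $\bar D$) to real $2n\times 2n$ matrices with $J^2=-I$. A $\mathcal{C}^1$ map $h:\Delta\to D$ is $J$-holomorphic if $J\circ dh=dh\circ J_{st}$. Levi form: for a $\mathcal{C}^2$ function $u$, $\mathcal{L}^Ju(X)=d(d^c_Ju)(X,JX)$ where $d^c_Ju(X)=-du(JX)$. $\lambda_0(D,J,u)$ is the minimum of $\mathcal{L}^J_xu(X)/\|X\|^2$ over $x\in\bar D$, $X\neq 0$. The function $u$ is strictly $J$-plurisubharmonic on $D$ if $\lambda_0(D,J,u)>0$.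 $\mathcal{C}^1$ norm: for matrix-valued $J$, $\|J_p\|_0$ is the Euclidean operator norm, $\|J_p\|_1=\|J_p\|_0+\big(\sum_{i=1}^{2n}\|(\partial J_{i,j}/\partial x_k)_{j,k}(p)\|_0^2\big)^{1/2}$ and $\|J\|_{\mathcal{C}^1(\bar D)}=\max_{p\in\bar D}\|J_p\|_1$. Kobayashi pseudometric: $K_{(D,J)}(p,v)=\inf\{\alpha>0:\ \exists\, h:\Delta\to D\ J\text{-holomorphic},\ h(0)=p,\ (\partial h/\partial x)(0)=v/\alpha\}$. *)

(* Defs.v *)
From HB Require Import structures.
From mathcomp Require Import all_boot all_order all_algebra.
From mathcomp Require Import all_classical all_reals all_analysis.

Set Implicit Arguments.
Unset Strict Implicit.
Unset Printing Implicit Defensive.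

Import Order.TTheory GRing.Theory Num.Theory.
Import numFieldNormedType.Exports.

Local Open Scope classical_set_scope.
Local Open Scope ring_scope.

(* R^{2n} is 'cV[R]_(n + n), so that matrices act on the left, and C is
   R^2 = 'cV[R]_(1 + 1), with multiplication by i given by Jst R 1.  Maps that
   are only meant on a set are total functions; all the definitions below
   depend only on their values on that set. *)

Section Euclidean.
Context {R : realType}.

(* The library norm `|x| on matrices is the sup norm, which induces the same
   topology and the same notion of differential. *)
Definition enorm m (x : 'cV[R]_m) : R := Num.sqrt (\sum_i x i 0 ^+ 2).

Definition eball m : set 'cV[R]_m := [set x | enorm x < 1].

Definition opnorm m p (A : 'M[R]_(m, p)) : R :=
  sup [set enorm (A *m x) | x in [set x : 'cV[R]_p | enorm x <= 1]].

End Euclidean.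

Definition is_domain (T : topologicalType) (D : set T) : Prop :=
  [/\ D !=set0, open D & connected D].

Section Closure.
Context {R : realType} {V : normedModType R}.

(* Continuous extension to the closure of D of a function given on D. *)
Definition ext_closure (D : set V) (g : V -> R) (x : V) : R :=
  lim (g y @[y --> within D (nbhs x)]).

Definition cont_upto (W : normedModType R) (D : set V) (g : V -> W) : Prop :=
  exists2 G : V -> W,
    {within closure D, continuous G} & forall x, D x -> G x = g x.

(* Class C^k on the closure of the open set D: class C^k on D, all derivatives
   of order at most k extending continuously to the closure.  No regularity of
   the boundary and no extension to a neighbourhood is required. *)
Definition C1_upto (W : normedModType R) (D : set V) (g : V -> W) : Prop :=
  [/\ forall x, D x -> differentiable g x,
      cont_upto D g
    & forall v : V, cont_upto D ('D_v g)].

Definition C2_upto (D : set V) (u : V -> R) : Prop :=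
  C1_upto D u /\ forall v : V, C1_upto D ('D_v u : V -> R).

Definition C1_on (U V' : normedModType R) (A : set U) (h : U -> V') : Prop :=
  (forall z, A z -> differentiable h z) /\
  forall w z, A z -> {for z, continuous ('D_w h)}.

End Closure.

Section AlmostComplex.
Context {R : realType}.

Definition Jst n : 'M[R]_(n + n) :=
  block_mx (0 : 'M[R]_n) (- 1%:M) 1%:M (0 : 'M[R]_n).

Definition almost_complex n (D : set 'cV[R]_(n + n))
    (J : 'cV[R]_(n + n) -> 'M[R]_(n + n)) : Prop :=
  forall x, D x -> J x *m J x = - 1%:M.

(* The exterior derivative of a 1-form, evaluated on constant vector fields;
   there is no factor 1/2. *)
Definition dform m (alpha : 'cV[R]_m -> 'cV[R]_m -> R)
    (x X Y : 'cV[R]_m) : R :=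
  'D_X (fun y => alpha y Y) x - 'D_Y (fun y => alpha y X) x.

Definition dc n (J : 'cV[R]_(n + n) -> 'M[R]_(n + n)) (u : 'cV[R]_(n + n) -> R)
    (x X : 'cV[R]_(n + n)) : R :=
  - 'd u x (J x *m X).

Definition levi n (J : 'cV[R]_(n + n) -> 'M[R]_(n + n))
    (u : 'cV[R]_(n + n) -> R) (x X : 'cV[R]_(n + n)) : R :=
  dform (dc J u) x X (J x *m X).

(* When D is bounded and nonempty, 0 < n, and J and u are of class C^1 and C^2
   on the closure of D, this infimum is attained, by compactness. *)
Definition lambda0 n (D : set 'cV[R]_(n + n))
    (J : 'cV[R]_(n + n) -> 'M[R]_(n + n)) (u : 'cV[R]_(n + n) -> R) : R :=
  inf [set l | exists x X, [/\ closure D x, X != 0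
    & l = ext_closure D (fun y => levi J u y X) x / enorm X ^+ 2]].

Definition strictly_psh n (D : set 'cV[R]_(n + n))
    (J : 'cV[R]_(n + n) -> 'M[R]_(n + n)) (u : 'cV[R]_(n + n) -> R) : Prop :=
  0 < lambda0 D J u.

Definition norm1_at m (M : 'cV[R]_m -> 'M[R]_m) (p : 'cV[R]_m) : R :=
  opnorm (M p) +
  Num.sqrt (\sum_i
    opnorm (\matrix_(j, k) 'D_(delta_mx k 0) (fun y => M y i j) p) ^+ 2).

(* Extended-real valued only so that the supremum is always meaningful: it is a
   finite maximum when D is bounded and M is of class C^1 on its closure. *)
Definition C1norm m (D : set 'cV[R]_m) (M : 'cV[R]_m -> 'M[R]_m) : \bar R :=
  ereal_sup [set (ext_closure D (norm1_at M) p)%:E | p in closure D].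

Definition Delta : set 'cV[R]_(1 + 1) := @eball R (1 + 1).

Definition Jholomorphic n (D : set 'cV[R]_(n + n))
    (J : 'cV[R]_(n + n) -> 'M[R]_(n + n))
    (h : 'cV[R]_(1 + 1) -> 'cV[R]_(n + n)) : Prop :=
  [/\ forall z, Delta z -> D (h z),
      C1_on Delta h
    & forall z, Delta z -> forall w : 'cV[R]_(1 + 1),
        J (h z) *m 'd h z w = 'd h z (Jst 1 *m w)].

(* delta_mx 0 0 is the unit vector d/dx of C = R^2.  The infimum of the empty
   set is +oo. *)
Definition Kobayashi n (D : set 'cV[R]_(n + n))
    (J : 'cV[R]_(n + n) -> 'M[R]_(n + n)) (p v : 'cV[R]_(n + n)) : \bar R :=
  ereal_inf [set alpha%:E | alpha in [set alpha : R | 0 < alpha /\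
    exists h, [/\ Jholomorphic D J h, h 0 = p
                & 'D_(delta_mx 0 0) h 0 = alpha^-1 *: v]]].

End AlmostComplex.

Arguments Jst : clear implicits.

(* Main.v *)
Require Import Defs.
From HB Require Import structures.
From mathcomp Require Import all_boot all_order all_algebra.
From mathcomp Require Import all_classical all_reals all_analysis.
From mathcomp Require Import ring lra.

Set Implicit Arguments.
Unset Strict Implicit.
Unset Printing Implicit Defensive.

Import Order.TTheory GRing.Theory Num.Theory.
Import numFieldNormedType.Exports.

Local Open Scope classical_set_scope.
Local Open Scope ring_scope.

(** The number K(p, v) is the infimum of the alpha such that some J-holomorphic
    disc h has h 0 = p and derivative v / alpha along the real axis at 0.  So
    the claim is an upper bound for the derivative of h at 0, namely
<<
      lambda0 * |'D_e1 h 0| ^ 2 <= C * |u p|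
>>
    with an absolute constant C; the factor e^(- 2 t) is at most 1.

    The function u o h is negative, and its Laplacian is the Levi form of u at
    the derivative of h, hence at least lambda0 |'D_e1 h|^2.  Two difficulties
    arise.  First, h is only of class C^1, so that u o h has no pointwise
    second derivatives.  The Laplacian is therefore replaced by the asymptotics
    of means over small circles (circle_lapl_ge), which suffices for the
    maximum principle (circle_max_principle).  These asymptotics follow from
    Stokes' formula on small circles for the pull-back by h of the form d^c u,
    which is of class C^1 (infinitesimal_stokes, comp_circle_lapl).

    Second, a function with Levi form bounded below and a logarithmic pole at
    p, as in the usual proof, would need J(x) - J(p) = O(|x - p|) on D,
    which may fail since D need not be convex.  Instead, all comparisons of J
    are made along the disc.  Let zs maximize (1/4 - |z|)^2 |'D_e1 h z| on the
    disc of radius 1/4 (exists_bubble), let M be the speed at zs and rho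
    half the distance from zs to the boundary circle.  The speed is at most
    4 M on the disc of radius rho around zs.  The derivative of h at a point z
    is approximated by the mean over a circle of radius r of the values of h,
    rotated by means of the constant structure J (h z); the error is of order
    eps M^2 r (rot_mean_estimate).  As h is bounded, this implies
    M rho <= 6 (bubble_scale), and then that the speed is at least M / 2 on
    the disc of radius s = rho / 1000 around zs (bubble_speed).

    So the Laplacian of u o h is at least lambda0 M^2 / 4 on that small disc,
    and it is nonnegative elsewhere.  The maximum principle applied to the sum
    of u o h and of a multiple of s^2 / (s^2 + |z - zs|^2), a function which is
    subharmonic away from the small disc, transfers this to the origin:
    |u p| is at least of order lambda0 M^2 s^4 (speed_bound).  Finally the
    speed at 0 is at most 64 rho^2 M by the choice of zs. *)

(** * The Euclidean norm and the operator norm *)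

Section EuclideanFacts.
Context {R : realType}.

Definition dotp m (u v : 'cV[R]_m) : R := \sum_i u i 0 * v i 0.

Lemma dotpC m (u v : 'cV[R]_m) : dotp u v = dotp v u.
Proof. by apply: eq_bigr => i _; rewrite mulrC. Qed.

Lemma dotpDr m (u v w : 'cV[R]_m) : dotp u (v + w) = dotp u v + dotp u w.
Proof. by rewrite -big_split; apply: eq_bigr => i _; rewrite mxE mulrDr. Qed.

Lemma dotpZr m (u v : 'cV[R]_m) a : dotp u (a *: v) = a * dotp u v.
Proof. by rewrite mulr_sumr; apply: eq_bigr => i _; rewrite mxE mulrCA. Qed.

Lemma dotpNr m (u v : 'cV[R]_m) : dotp u (- v) = - dotp u v.
Proof. by rewrite -scaleN1r dotpZr mulN1r. Qed.

Lemma dotpBr m (u v w : 'cV[R]_m) : dotp u (v - w) = dotp u v - dotp u w.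
Proof. by rewrite dotpDr dotpNr. Qed.

Lemma dotp0r m (u : 'cV[R]_m) : dotp u 0 = 0.
Proof. by rewrite /dotp big1// => i _; rewrite mxE mulr0. Qed.

Lemma dotpDl m (u v w : 'cV[R]_m) : dotp (v + w) u = dotp v u + dotp w u.
Proof. by rewrite dotpC dotpDr !(dotpC u). Qed.

Lemma dotpZl m (u v : 'cV[R]_m) a : dotp (a *: v) u = a * dotp v u.
Proof. by rewrite dotpC dotpZr dotpC. Qed.

Lemma dotp_mulmx m p (A : 'M[R]_(m, p)) u v :
  dotp u (A *m v) = dotp (A^T *m u) v.
Proof.
transitivity (\sum_i \sum_j u i 0 * A i j * v j 0).
  apply: eq_bigr => i _; rewrite mxE mulr_sumr.
  by apply: eq_bigr => j _; rewrite mulrA.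
rewrite exchange_big; apply: eq_bigr => j _; rewrite mxE mulr_suml.
by apply: eq_bigr => i _; rewrite mxE (mulrC (A i j)).
Qed.

Lemma dotp_ge0 m (u : 'cV[R]_m) : 0 <= dotp u u.
Proof. by apply: sumr_ge0 => i _; rewrite -expr2 sqr_ge0. Qed.

Lemma enorm_ge0 m (x : 'cV[R]_m) : 0 <= enorm x.
Proof. exact: sqrtr_ge0. Qed.

Lemma enorm_sqr m (x : 'cV[R]_m) : enorm x ^+ 2 = dotp x x.
Proof.
rewrite /enorm sqr_sqrtr; first by apply: eq_bigr => i _; rewrite expr2.
by apply: sumr_ge0 => i _; rewrite sqr_ge0.
Qed.

Lemma enorm0 m : enorm (0 : 'cV[R]_m) = 0.
Proof. by apply/eqP; rewrite -sqrf_eq0 enorm_sqr dotp0r. Qed.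

Lemma enorm_eq0 m (x : 'cV[R]_m) : (enorm x == 0) = (x == 0).
Proof.
apply/idP/eqP => [|->]; last by rewrite enorm0.
rewrite -sqrf_eq0 enorm_sqr psumr_eq0 => [/allP x0|i _]; last first.
  by rewrite -expr2 sqr_ge0.
apply/matrixP => i j; rewrite ord1 mxE.
by have := x0 i (mem_index_enum i); rewrite /= mulf_eq0 orbb => /eqP.
Qed.

Lemma enormZ m (x : 'cV[R]_m) a : enorm (a *: x) = `|a| * enorm x.
Proof.
apply/eqP; rewrite -(eqrXn2 (n := 2))// ?mulr_ge0 ?enorm_ge0//.
by rewrite exprMn !enorm_sqr dotpZl dotpZr real_normK ?num_real// expr2 mulrA.
Qed.

Lemma enormN m (x : 'cV[R]_m) : enorm (- x) = enorm x.
Proof. by rewrite -scaleN1r enormZ normrN1 mul1r. Qed.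

Lemma enormBC m (x y : 'cV[R]_m) : enorm (x - y) = enorm (y - x).
Proof. by rewrite -enormN opprB. Qed.

Lemma cauchy_schwarz m (u v : 'cV[R]_m) : dotp u v <= enorm u * enorm v.
Proof.
have [->|v0] := eqVneq v 0; first by rewrite dotp0r enorm0 mulr0.
have nv : 0 < enorm v by rewrite lt_def enorm_eq0 v0 enorm_ge0.
rewrite (le_trans (ler_norm _))//.
rewrite -(ler_pXn2r (n := 2))// ?nnegrE ?mulr_ge0 ?enorm_ge0//.
rewrite real_normK ?num_real// exprMn !enorm_sqr.
have := dotp_ge0 (dotp v v *: u - dotp u v *: v).
rewrite !(dotpBr, dotpDl, dotpZr, dotpZl) -scaleN1r !(dotpZr, dotpZl) (dotpC v u).
have : 0 < dotp v v by rewrite -enorm_sqr exprn_gt0.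
set a := dotp u v; set b := dotp v v; set c := dotp u u => b0 H.
have : 0 <= b * (c * b - a ^+ 2) by move: H; congr (_ <= _); ring.
by rewrite pmulr_rge0// subr_ge0.
Qed.

Lemma normr_dotp m (u v : 'cV[R]_m) : `|dotp u v| <= enorm u * enorm v.
Proof.
rewrite ler_norml cauchy_schwarz andbT lerNl -dotpNr.
by rewrite (le_trans (cauchy_schwarz _ _))// enormN.
Qed.

(** Vectors are estimated through their scalar products: only scalar functions
    have to be integrated or expanded, and no constant depends on the
    dimension. *)
Lemma enorm_le_dual m (x : 'cV[R]_m) a : 0 <= a ->
  (forall w, dotp w x <= enorm w * a) -> enorm x <= a.
Proof.
move=> a0 /(_ x); rewrite -enorm_sqr expr2.
have [->|x0] := eqVneq x 0; first by rewrite enorm0.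
by rewrite ler_pM2l// lt_def enorm_eq0 x0 enorm_ge0.
Qed.

Lemma enormD m (x y : 'cV[R]_m) : enorm (x + y) <= enorm x + enorm y.
Proof.
apply: enorm_le_dual => [|w]; first by rewrite addr_ge0 ?enorm_ge0.
by rewrite dotpDr mulrDr lerD// cauchy_schwarz.
Qed.

Lemma continuous_sumr (T : topologicalType) (I : Type) (r : seq I)
    (f : I -> T -> R) x :
  (forall i, {for x, continuous (f i)}) ->
  {for x, continuous (fun y => \sum_(i <- r) f i y)}.
Proof.
move=> fc; elim: r => [|i r IH].
  rewrite (_ : (fun y => _) = cst 0); first exact: cst_continuous.
  by apply/funext => y; rewrite big_nil.
rewrite (_ : (fun y => _) = f i \+ (fun y => \sum_(i <- r) f i y)).
  by apply: continuousD; [exact: fc|exact: IH].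
by apply/funext => y; rewrite big_cons.
Qed.

Lemma continuous_sqr (T : topologicalType) (f : T -> R) x :
  {for x, continuous f} -> {for x, continuous (fun y => f y ^+ 2)}.
Proof. by move=> fc; exact: (continuous_comp fc (@exprn_continuous R 2 _)). Qed.

Lemma continuous_sqrt (T : topologicalType) (f : T -> R) x :
  {for x, continuous f} -> {for x, continuous (fun y => Num.sqrt (f y))}.
Proof. by move=> fc; exact: (continuous_comp fc (@sqrt_continuous R _)). Qed.

Lemma enorm_continuous m : continuous (@enorm R m).
Proof.
move=> x; apply: continuous_sqrt.
apply: continuous_sumr => i.
by apply: continuous_sqr; exact: coord_continuous.
Qed.

Lemma dotp_continuous m (w : 'cV[R]_m) : continuous (dotp w).
Proof.
move=> x; apply: continuous_sumr => i.
by apply: continuousM; [exact: cst_continuous|exact: coord_continuous].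
Qed.

(** The Hilbert-Schmidt norm dominates the operator norm and is explicit in the
    entries; continuity of operator norms is derived from it. *)
Definition hsnorm m p (A : 'M[R]_(m, p)) : R :=
  Num.sqrt (\sum_i \sum_j A i j ^+ 2).

Lemma hsnorm0 m p : hsnorm (0 : 'M[R]_(m, p)) = 0.
Proof.
by rewrite /hsnorm !big1 ?sqrtr0// => i _; rewrite big1// => j _; rewrite mxE expr0n.
Qed.

Lemma enorm_mulmx_rows m p (A : 'M[R]_(m, p)) (c : 'I_m -> R) v :
  (forall i, `|(A *m v) i 0| <= c i * enorm v) ->
  enorm (A *m v) <= Num.sqrt (\sum_i c i ^+ 2) * enorm v.
Proof.
move=> Ac.
rewrite -(ler_pXn2r (n := 2))// ?nnegrE ?mulr_ge0 ?enorm_ge0 ?sqrtr_ge0//.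
rewrite exprMn [X in _ <= X * _]sqr_sqrtr; last by apply: sumr_ge0 => i _; exact: sqr_ge0.
rewrite enorm_sqr mulr_suml; apply: ler_sum => i _.
by rewrite -expr2 -exprMn -[leLHS]real_normK ?num_real// lerXn2r ?nnegrE// (le_trans _ (Ac i)).
Qed.

Lemma enorm_mulmx_hs m p (A : 'M[R]_(m, p)) v :
  enorm (A *m v) <= hsnorm A * enorm v.
Proof.
have -> : hsnorm A = Num.sqrt (\sum_i enorm ((row i A)^T) ^+ 2).
  rewrite /hsnorm; congr Num.sqrt; apply: eq_bigr => i _.
  by rewrite enorm_sqr; apply: eq_bigr => j _; rewrite !mxE expr2.
apply: enorm_mulmx_rows => i; rewrite mxE.
rewrite (_ : \sum_j _ = dotp (row i A)^T v) ?normr_dotp//.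
by apply: eq_bigr => j _; rewrite !mxE.
Qed.

Lemma opnorm_set_sup m p (A : 'M[R]_(m, p)) :
  has_sup [set enorm (A *m x) | x in [set x : 'cV[R]_p | enorm x <= 1]].
Proof.
split; first by exists (enorm (A *m 0)), 0 => //=; rewrite enorm0.
exists (hsnorm A) => _ /= [x x1 <-].
rewrite (le_trans (enorm_mulmx_hs _ _))// -[leRHS]mulr1 ler_wpM2l//.
exact: sqrtr_ge0.
Qed.

Lemma enorm_mulmx m p (A : 'M[R]_(m, p)) v :
  enorm (A *m v) <= opnorm A * enorm v.
Proof.
have [->|v0] := eqVneq v 0; first by rewrite mulmx0 !enorm0 mulr0.
have nv : 0 < enorm v by rewrite lt_def enorm_eq0 v0 enorm_ge0.
rewrite -ler_pdivrMr// mulrC.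
have -> : (enorm v)^-1 * enorm (A *m v) = enorm (A *m ((enorm v)^-1 *: v)).
  by rewrite -scalemxAr enormZ ger0_norm// invr_ge0 enorm_ge0.
apply: sup_upper_bound; first exact: opnorm_set_sup.
exists ((enorm v)^-1 *: v) => //=.
by rewrite enormZ ger0_norm ?invr_ge0 ?enorm_ge0// mulVf// gt_eqF.
Qed.

Lemma opnorm_le m p (A : 'M[R]_(m, p)) a :
  (forall x, enorm x <= 1 -> enorm (A *m x) <= a) -> opnorm A <= a.
Proof.
move=> Aa; apply: ge_sup; first by case: (opnorm_set_sup A).
by move=> _ /= [x x1 <-]; exact: Aa.
Qed.

Lemma opnorm_ge0 m p (A : 'M[R]_(m, p)) : 0 <= opnorm A.
Proof.
apply: (@le_trans _ _ (enorm (A *m 0))); first exact: enorm_ge0.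
apply: sup_upper_bound; first exact: opnorm_set_sup.
by exists 0 => //=; rewrite enorm0.
Qed.

Lemma opnorm_triangle m p (A B : 'M[R]_(m, p)) :
  opnorm A <= opnorm B + hsnorm (A - B).
Proof.
apply: opnorm_le => x x1.
have -> : A *m x = B *m x + (A - B) *m x by rewrite -mulmxDl addrC subrK.
apply: (le_trans (enormD _ _)); apply: lerD.
  apply: (le_trans (enorm_mulmx _ _)).
  by rewrite -[leRHS]mulr1 ler_wpM2l ?opnorm_ge0.
apply: (le_trans (enorm_mulmx_hs _ _)).
by rewrite -[leRHS]mulr1 ler_wpM2l// sqrtr_ge0.
Qed.

Lemma hsnormN m p (A : 'M[R]_(m, p)) : hsnorm (- A) = hsnorm A.
Proof.
congr Num.sqrt; apply: eq_bigr => i _; apply: eq_bigr => j _.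
by rewrite mxE sqrrN.
Qed.

Lemma continuous_dominated (T : topologicalType) (f g : T -> R) x :
  {for x, continuous g} -> g x = 0 -> (forall y, `|f x - f y| <= g y) ->
  {for x, continuous f}.
Proof.
move=> gc g0 fg; apply/cvgrPdist_le => e e0; near=> y.
apply: (le_trans (fg y)); apply: (le_trans (ler_norm _)).
near: y; apply: cvgr0_norm_le => //.
by move: gc; rewrite /prop_for /continuous_at g0.
Unshelve. all: by end_near. Qed.

End EuclideanFacts.

(** * Derivatives and the C^1 norm on an open set *)

Section DerivativeTools.
Context {R : realType}.

Lemma is_derive_linear (V W W' : normedModType R) (l : W -> W')
    (f : V -> W) x v df :
  linear l -> continuous l -> is_derive x v f df ->
  is_derive x v (l \o f) (l df).
Proof.
move=> ll lc [fx <-].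
pose L : {linear W -> W'} := HB.pack l (GRing.isLinear.Build R W W' _ l ll).
have lim_l h : (l \o f) (h *: v + x) - (l \o f) x = L (f (h *: v + x) - f x).
  by rewrite (linearB L).
have C : h^-1 *: ((l \o f \o shift x) (h *: v) - (l \o f) x) @[h --> 0^'] -->
    l ('D_v f x).
  under eq_fun do rewrite [X in _ *: X]lim_l -(linearZ_LR L).
  have H : h^-1 *: ((f \o shift x) (h *: v) - f x) @[h --> 0^'] --> 'D_v f x.
    exact: fx.
  exact: (cvg_comp _ _ H (lc _)).
by split; [apply/cvg_ex; exists (l ('D_v f x))|exact: cvg_lim C].
Qed.

Lemma differentiable_linear (V W W' : normedModType R) (l : W -> W')
    (f : V -> W) x :
  linear l -> continuous l -> differentiable f x -> differentiable (l \o f) x.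
Proof.
move=> ll lc fx; apply: differentiable_comp => //.
pose L : {linear W -> W'} := HB.pack l (GRing.isLinear.Build R W W' _ l ll).
exact: (@linear_differentiable _ _ _ L).
Qed.

Lemma is_derive_curve (V W : normedModType R) (f : V -> W) (g : R -> V) t dg :
  differentiable f (g t) -> is_derive t 1 g dg ->
  is_derive t 1 (f \o g) ('d f (g t) dg).
Proof.
move=> fd [gt <-]; have gd : differentiable g t by apply/derivable1_diffP.
have fgd : differentiable (f \o g) t by apply: differentiable_comp.
split; first by apply/derivable1_diffP.
by rewrite deriveE// diff_comp//= deriveE.
Qed.

Lemma derive_coordE m (W : normedModType R) (f : 'cV[R]_m -> W) x X :
  differentiable f x ->
  'D_X f x = \sum_i X i 0 *: 'D_(delta_mx i 0) f x.
Proof.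
move=> fx; rewrite deriveE// [X in 'd f x X]matrix_sum_delta.
rewrite linear_sum; apply: eq_bigr => i _.
by rewrite big_ord1 linearZ deriveE.
Qed.

Lemma near_open (V : topologicalType) (D : set V) (P : V -> Prop) x :
  open D -> D x -> (forall y, D y -> P y) -> \forall y \near x, P y.
Proof. by move=> oD Dx DP; apply: filterS (open_nbhs_nbhs (conj oD Dx)) => y /DP. Qed.

Lemma continuous_open_eq (V : topologicalType) (W : topologicalType)
    (D : set V) (f g : V -> W) x :
  open D -> D x -> (forall y, D y -> f y = g y) ->
  {for x, continuous f} -> {for x, continuous g}.
Proof.
move=> oD Dx fg fc; rewrite /prop_for /continuous_at -fg//.
apply: cvg_trans fc; apply: near_eq_cvg.
by apply: near_open Dx _ => // y Dy; rewrite fg.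
Qed.

Lemma cont_upto_continuous (V W : normedModType R) (D : set V) (g : V -> W) x :
  open D -> cont_upto D g -> D x -> {for x, continuous g}.
Proof.
move=> oD [G Gc GE] Dx; apply: (continuous_open_eq oD Dx GE).
have : {in D, continuous G}.
  rewrite -continuous_open_subspace//.
  by apply: continuous_subspaceW Gc; exact: subset_closure.
by apply; rewrite inE.
Qed.

(** At a point of D the extension by continuity is the function itself, so the
    norm and the Levi form at the points of D are controlled by their
    extensions to the closure. *)
Lemma ext_closure_in (V : normedModType R) (D : set V) (g : V -> R) x :
  open D -> D x -> {for x, continuous g} -> ext_closure D g x = g x.
Proof.
move=> oD Dx gc; rewrite /ext_closure within_interior; first exact: cvg_lim.
by move: oD; rewrite openE; exact.
Qed.

Section Entries.
Variables (V : normedModType R) (m p : nat) (M : V -> 'M[R]_(m, p)).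

Let coord_linear i j : linear (fun A : 'M[R]_(m, p) => A i j : R).
Proof. by move=> a A B; rewrite !mxE. Qed.

Lemma is_derive_entry x v dM i j :
  is_derive x v M dM -> is_derive x v (fun y => M y i j : R) (dM i j).
Proof.
exact: (is_derive_linear (coord_linear i j) (@coord_continuous _ _ _ _ _)).
Qed.

Lemma derive_entry x v i j :
  derivable M x v -> 'D_v (fun y => M y i j : R) x = 'D_v M x i j.
Proof. by move=> Mx; case: (is_derive_entry i j (derivableP Mx)). Qed.

Lemma differentiable_entry x i j :
  differentiable M x -> differentiable (fun y => M y i j : R) x.
Proof.
exact: (differentiable_linear (coord_linear i j) (@coord_continuous _ _ _ _ _)).
Qed.

Lemma continuous_entry x i j :
  {for x, continuous M} -> {for x, continuous (fun y => M y i j : R)}.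
Proof. by move=> Mx; exact: (continuous_comp Mx (@coord_continuous _ _ _ _ _ _)). Qed.

End Entries.

Section DotpDerivative.
Variables (V : normedModType R) (m : nat) (w : 'cV[R]_m) (f : V -> 'cV[R]_m).

Let dotp_linear : linear (dotp w : 'cV[R]_m -> R).
Proof. by move=> a x y; rewrite dotpDr dotpZr. Qed.

Lemma is_derive_dotp x v df :
  is_derive x v f df -> is_derive x v (fun y => dotp w (f y)) (dotp w df).
Proof. exact: (is_derive_linear dotp_linear (@dotp_continuous _ _ w)). Qed.

Lemma differentiable_dotp x :
  differentiable f x -> differentiable (fun y => dotp w (f y)) x.
Proof. exact: (differentiable_linear dotp_linear (@dotp_continuous _ _ w)). Qed.

Lemma derive_dotp x v :
  derivable f x v -> 'D_v (fun y => dotp w (f y)) x = dotp w ('D_v f x).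
Proof. by move=> fx; case: (is_derive_dotp (derivableP fx)). Qed.

Lemma continuous_dotp x :
  {for x, continuous f} -> {for x, continuous (fun y => dotp w (f y))}.
Proof. by move=> fc; exact: (continuous_comp fc (@dotp_continuous _ _ w _)). Qed.

End DotpDerivative.

End DerivativeTools.

Section ComplexStructure.
Context {R : realType} {m : nat}.
Variables (D : set 'cV[R]_m) (M : 'cV[R]_m -> 'M[R]_m).

Lemma opnorm_comp_continuous (T : topologicalType) p q
    (B : T -> 'M[R]_(p, q)) x :
  (forall i j, {for x, continuous (fun y => B y i j)}) ->
  {for x, continuous (fun y => opnorm (B y))}.
Proof.
move=> Bc.
apply: (@continuous_dominated _ _ _ (fun y => hsnorm (B x - B y))).
- apply: continuous_sqrt.
  apply: continuous_sumr => i; apply: continuous_sumr => j.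
  rewrite (_ : (fun y => _) = (fun y => (B x i j - B y i j) ^+ 2)); last first.
    by apply/funext => y; rewrite !mxE.
  apply: continuous_sqr.
  by apply: continuousB; [exact: cst_continuous|exact: Bc].
- by rewrite subrr hsnorm0.
- move=> y; have := opnorm_triangle (B x) (B y).
  have := opnorm_triangle (B y) (B x).
  rewrite -[B y - B x]opprB hsnormN ler_norml => H1 H2.
  by apply/andP; split; lra.
Qed.

Lemma norm1_at_continuous x : open D -> D x -> C1_upto D M ->
  {for x, continuous (norm1_at M)}.
Proof.
move=> oD Dx [Md Mc dMc].
have Mx y : D y -> {for y, continuous M} by move=> Dy; exact: cont_upto_continuous Dy.
apply: continuousD.
  by apply: opnorm_comp_continuous => i j; apply: continuous_entry; exact: Mx.
apply: continuous_sqrt.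
apply: continuous_sumr => i.
apply: continuous_sqr.
apply: opnorm_comp_continuous => j k.
apply: (continuous_open_eq oD Dx (f := fun y => 'D_(delta_mx k 0) M y i j)).
  by move=> y Dy; rewrite mxE derive_entry//; apply: diff_derivable; exact: Md.
by apply: continuous_entry; exact: cont_upto_continuous (dMc _) Dx.
Qed.

Lemma C1norm_ge x e : open D -> D x -> C1_upto D M ->
  (C1norm D M <= e%:E)%E -> norm1_at M x <= e.
Proof.
move=> oD Dx M1 Me; rewrite -lee_fin; apply: le_trans Me.
apply: ereal_sup_ubound; exists x; first exact: subset_closure.
by rewrite ext_closure_in//; exact: norm1_at_continuous.
Qed.

(** The i-th row of 'D_X M is B i applied to X, where B i is the Jacobian matrix
    of the i-th row of M; the sum of the squares of the norms of the B i, which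
    enters norm1_at, therefore bounds the derivative as an operator on v. *)
Lemma derive_mulmx_le x X v : differentiable M x ->
  enorm ('D_X M x *m v) <= norm1_at M x * enorm X * enorm v.
Proof.
move=> Mx.
pose B i := \matrix_(j, k) 'D_(delta_mx k 0) (fun y => M y i j) x.
have row_DM i : ('D_X M x *m v) i 0 = dotp (B i *m X) v.
  rewrite mxE; apply: eq_bigr => j _; congr (_ * _).
  rewrite derive_coordE// summxE mxE; apply: eq_bigr => k _.
  by rewrite !mxE derive_entry 1?mulrC//; exact: diff_derivable.
apply: (@le_trans _ _ (Num.sqrt (\sum_i (opnorm (B i) * enorm X) ^+ 2) * enorm v)).
  apply: enorm_mulmx_rows => i; rewrite row_DM (le_trans (normr_dotp _ _))//.
  by rewrite ler_wpM2r ?enorm_ge0// enorm_mulmx.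
rewrite ler_wpM2r ?enorm_ge0//.
under eq_bigr do rewrite exprMn.
rewrite -mulr_suml sqrtrM; last by apply: sumr_ge0 => i _; exact: sqr_ge0.
rewrite sqrtr_sqr ger0_norm ?enorm_ge0// ler_wpM2r ?enorm_ge0//.
by rewrite /norm1_at lerDr opnorm_ge0.
Qed.

End ComplexStructure.

(** * The Levi form as an exterior derivative *)

Section FiniteSums.
Context {R : realType} {V : normedModType R}.

Lemma is_derive_sumr n (f : 'I_n -> V -> R) df x v :
  (forall i, is_derive x v (f i) (df i)) ->
  is_derive x v (fun y => \sum_i f i y) (\sum_i df i).
Proof.
move=> fd; rewrite (_ : (fun y => _) = \sum_i f i); first exact: is_derive_sum.
by apply/funext => y; rewrite fct_sumE.
Qed.

Lemma differentiable_sumr n (f : 'I_n -> V -> R) x :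
  (forall i, differentiable (f i) x) ->
  differentiable (fun y => \sum_i f i y) x.
Proof.
move=> fd; rewrite (_ : (fun y => _) = \sum_i f i).
  exact: differentiable_sum.
by apply/funext => y; rewrite fct_sumE.
Qed.

Lemma is_derive_mul (f g : V -> R) df dg x v :
  is_derive x v f df -> is_derive x v g dg ->
  is_derive x v (fun y => f y * g y) (df * g x + f x * dg).
Proof.
move=> fd gd; apply: (is_derive_eq (is_deriveM fd gd)).
by rewrite addrC; congr (_ + _); rewrite -[LHS]/(_ * _) mulrC.
Qed.

Lemma is_derive_mulr (f : V -> R) df x v a :
  is_derive x v f df -> is_derive x v (fun y => f y * a) (df * a).
Proof.
move=> fd; apply: (is_derive_eq (is_derive_mul fd (is_derive_cst a x v))).
by rewrite mulr0 addr0.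
Qed.

End FiniteSums.

Section LeviForm.
Context {R : realType} {n : nat}.
Variables (D : set 'cV[R]_(n + n)) (J : 'cV[R]_(n + n) -> 'M[R]_(n + n)).
Variable u : 'cV[R]_(n + n) -> R.
Hypotheses (oD : open D) (J1 : C1_upto D J) (u2 : C2_upto D u).

(** The coefficients of the 1-form d^c u in the coordinates of the space. *)
Definition dc_coef k y : R := - \sum_l 'D_(delta_mx l 0) u y * J y l k.

Let Jd y : D y -> differentiable J y. Proof. by case: J1 => + _ _; exact. Qed.
Let Jc y : D y -> {for y, continuous J}.
Proof. by case: J1 => _ h _ Dy; exact: (cont_upto_continuous oD h Dy). Qed.
Let dJc y v : D y -> {for y, continuous ('D_v J)}.
Proof. by case: J1 => _ _ /(_ v) h Dy; exact: (cont_upto_continuous oD h Dy). Qed.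
Let ud y : D y -> differentiable u y. Proof. by case: u2 => -[+ _ _] _; exact. Qed.
Let duc y v : D y -> {for y, continuous ('D_v u)}.
Proof. by case: u2 => -[_ _ /(_ v) h] _ Dy; exact: (cont_upto_continuous oD h Dy). Qed.
Let dud y v : D y -> differentiable ('D_v u) y.
Proof. by case: u2 => _ /(_ v)[+ _ _]; exact. Qed.
Let dduc y v w : D y -> {for y, continuous ('D_w ('D_v u))}.
Proof. by case: u2 => _ /(_ v)[_ _ /(_ w) h] Dy; exact: (cont_upto_continuous oD h Dy). Qed.

Lemma dcE y Y : D y -> dc J u y Y = \sum_k dc_coef k y * Y k 0.
Proof.
move=> Dy; have := derive_coordE (J y *m Y) (ud Dy).
rewrite deriveE; last exact: ud.
rewrite /dc => ->.
rewrite /dc_coef; under [RHS]eq_bigr do rewrite mulNr mulr_suml.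
rewrite sumrN exchange_big/=; congr (- _); apply: eq_bigr => l _.
rewrite mxE scaler_suml; apply: eq_bigr => k _.
by rewrite -[LHS]/(_ * _) mulrC mulrA.
Qed.

Lemma dc_coef_is_derive y k v : D y -> is_derive y v (dc_coef k)
  (- \sum_l ('D_v ('D_(delta_mx l 0) u) y * J y l k
             + 'D_(delta_mx l 0) u y * 'D_v J y l k)).
Proof.
move=> Dy; apply: is_deriveN; apply: is_derive_sumr => l.
apply: is_derive_mul.
  by apply: derivableP; apply: diff_derivable; exact: dud.
by apply: is_derive_entry; apply: derivableP; apply: diff_derivable; exact: Jd.
Qed.

Lemma dc_coef_differentiable y k : D y -> differentiable (dc_coef k) y.
Proof.
move=> Dy; apply: differentiableN; apply: differentiable_sumr => l.
by apply: differentiableM; [exact: dud|apply: differentiable_entry; exact: Jd].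
Qed.

Lemma dc_coef_derive_continuous y k v : D y ->
  {for y, continuous ('D_v (dc_coef k))}.
Proof.
move=> Dy; apply: (continuous_open_eq oD Dy (f := fun y =>
   - \sum_l ('D_v ('D_(delta_mx l 0) u) y * J y l k
             + 'D_(delta_mx l 0) u y * 'D_v J y l k))).
  by move=> z Dz; case: (dc_coef_is_derive k v Dz).
apply: continuousN; apply: continuous_sumr => l.
apply: continuousD; apply: continuousM.
- exact: dduc.
- by apply: continuous_entry; exact: Jc.
- exact: duc.
- by apply: continuous_entry; exact: dJc.
Qed.

Lemma leviE x X : D x -> levi J u x X =
  \sum_k ('D_X (dc_coef k) x * (J x *m X) k 0
          - 'D_(J x *m X) (dc_coef k) x * X k 0).
Proof.
move=> Dx; rewrite /levi /dform.
have E v Y : 'D_v (fun y => dc J u y Y) x = \sum_k 'D_v (dc_coef k) x * Y k 0.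
  rewrite (@near_eq_derive _ _ _ _ (fun y => \sum_k dc_coef k y * Y k 0)).
    have /(_ _) := @is_derive_sumr R _ _ (fun k y => dc_coef k y * Y k 0)
      (fun k => 'D_v (dc_coef k) x * Y k 0) x v.
    case=> // k; apply: is_derive_mulr; apply: derivableP.
    by apply: diff_derivable; exact: dc_coef_differentiable.
  by apply: near_open Dx _ => // y; exact: dcE.
by rewrite !E sumrB.
Qed.

Lemma levi_continuous x X : D x -> {for x, continuous (fun y => levi J u y X)}.
Proof.
move=> Dx; apply: (continuous_open_eq oD Dx (f := fun y =>
  \sum_k ('D_X (dc_coef k) y * (\sum_l J y k l * X l 0)
     - (\sum_m (\sum_l J y m l * X l 0) * 'D_(delta_mx m 0) (dc_coef k) y)
       * X k 0))).
  move=> y Dy; rewrite leviE//; apply: eq_bigr => k _; rewrite mxE.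
  congr (_ - _ * _); rewrite (@derive_coordE _ _ _ _ _ (J y *m X)).
    by apply: eq_bigr => m _; rewrite mxE.
  exact: dc_coef_differentiable.
have JXc k : {for x, continuous (fun y => \sum_l J y k l * X l 0)}.
  apply: continuous_sumr => l; apply: continuousM; last exact: cst_continuous.
  by apply: continuous_entry; exact: Jc.
apply: continuous_sumr => k; apply: continuousB; apply: continuousM.
- exact: dc_coef_derive_continuous.
- exact: JXc.
- apply: continuous_sumr => m; apply: continuousM; first exact: JXc.
  exact: dc_coef_derive_continuous.
- exact: cst_continuous.
Qed.

(** A positive infimum is a genuine one (the infimum of a set with no lower
    bound is 0 by convention), and by continuity of the Levi form the points
    of D contribute the values of the Levi form itself to it. *)
Lemma levi_ge x X : strictly_psh D J u -> D x ->
  lambda0 D J u * enorm X ^+ 2 <= levi J u x X.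
Proof.
move=> u_psh Dx; have [->|X0] := eqVneq X 0.
  by rewrite enorm0 expr0n mulr0 leviE// big1// => k _; rewrite mulmx0 !mxE !mulr0 subrr.
have nX : 0 < enorm X ^+ 2 by rewrite exprn_gt0// lt_def enorm_eq0 X0 enorm_ge0.
rewrite -ler_pdivlMr//.
move: u_psh; rewrite /strictly_psh /lambda0; set S := (X in inf X) => u_psh.
have [hS|nhS] := pselect (has_inf S); last first.
  by move: u_psh; rewrite inf_out// ltxx.
apply: ge_inf; first by case: hS.
exists x, X; split => //; first exact: subset_closure.
by rewrite ext_closure_in//; exact: levi_continuous.
Qed.

End LeviForm.

(** * Integrals over a period *)

Section CircleIntegral.
Context {R : realType}.
Implicit Types (f g : R -> R) (c : R).

Lemma continuous_const c : continuous ((fun=> c) : R -> R).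
Proof. by move=> x; exact: cvg_cst. Qed.

Lemma continuous_add f g : continuous f -> continuous g ->
  continuous (fun x => f x + g x).
Proof. by move=> fc gc x; exact: cvgD (fc x) (gc x). Qed.

Lemma continuous_sub f g : continuous f -> continuous g ->
  continuous (fun x => f x - g x).
Proof. by move=> fc gc x; exact: cvgB (fc x) (gc x). Qed.

Lemma continuous_mul f g : continuous f -> continuous g ->
  continuous (fun x => f x * g x).
Proof. by move=> fc gc x; exact: cvgM (fc x) (gc x). Qed.

Lemma continuous_opp f : continuous f -> continuous (fun x => - f x).
Proof. by move=> fc x; exact: cvgN (fc x). Qed.

Definition cint f : R :=
  \int[@lebesgue_measure R]_(x in `[0, pi *+ 2]) f x.

Lemma pi2_gt0 : 0 < pi *+ 2 :> R.
Proof. by rewrite mulrn_wgt0// pi_gt0. Qed.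

Lemma cint_integrable f : continuous f ->
  (@lebesgue_measure R).-integrable `[0, pi *+ 2] (EFin \o f).
Proof.
move=> fc; apply: continuous_compact_integrable; first exact: segment_compact.
exact: continuous_subspaceT.
Qed.

Lemma cintD f g : continuous f -> continuous g ->
  cint (fun x => f x + g x) = cint f + cint g.
Proof. by move=> fc gc; apply: RintegralD => //; exact: cint_integrable. Qed.

Lemma cintZ c f : continuous f -> cint (fun x => c * f x) = c * cint f.
Proof. by move=> fc; apply: RintegralZl => //; exact: cint_integrable. Qed.

Lemma cintB f g : continuous f -> continuous g ->
  cint (fun x => f x - g x) = cint f - cint g.
Proof. by move=> fc gc; apply: RintegralB => //; exact: cint_integrable. Qed.

Lemma cint_le f g : continuous f -> continuous g ->
  (forall x, f x <= g x) -> cint f <= cint g.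
Proof. by move=> fc gc fg; apply: le_Rintegral => //; exact: cint_integrable. Qed.

Lemma cint_cst c : cint (fun=> c) = c * (pi *+ 2).
Proof.
have mI : @lebesgue_measure R `[0, pi *+ 2]%classic = (pi *+ 2)%:E.
  by rewrite lebesgue_measure_itv/= lte_fin pi2_gt0 -EFinB subr0.
transitivity (c * fine (@lebesgue_measure R `[0, pi *+ 2]%classic)).
  exact: Rintegral_cst.
by rewrite mI.
Qed.

Lemma cint_norm_le f c : continuous f -> (forall x, `|f x| <= c) ->
  `|cint f| <= c * (pi *+ 2).
Proof.
move=> fc fle.
have cc := continuous_const.
have lb : cint (fun=> - c) <= cint f.
  by apply: cint_le => // x; have := fle x; rewrite ler_norml => /andP[].
have ub : cint f <= cint (fun=> c).
  by apply: cint_le => // x; exact: (le_trans (ler_norm _)).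
by rewrite ler_norml; apply/andP; split; [rewrite -mulNr|]; rewrite -cint_cst.
Qed.

Lemma continuous_sum_fun n (f : 'I_n -> R -> R) :
  (forall i, continuous (f i)) -> continuous (fun x => \sum_i f i x).
Proof. by move=> fc x; apply: continuous_sumr => i; exact: fc. Qed.

Lemma cint_sum n (f : 'I_n -> R -> R) : (forall i, continuous (f i)) ->
  cint (fun x => \sum_i f i x) = \sum_i cint (f i).
Proof.
elim: n f => [|n IH] f fc.
  rewrite big_ord0 (_ : (fun x => _) = fun=> 0); last first.
    by apply/funext => x; rewrite big_ord0.
  by rewrite cint_cst mul0r.
rewrite big_ord_recr/= -IH// -cintD//; last exact: continuous_sum_fun.
by congr cint; apply/funext => x; rewrite big_ord_recr.
Qed.

Lemma is_derive_continuous (F f : R -> R) :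
  (forall x : R, is_derive x 1 F (f x)) -> continuous F.
Proof.
move=> Ff x; apply: differentiable_continuous; apply/derivable1_diffP.
by have [] := Ff x.
Qed.

Lemma cint_derive (F f : R -> R) : continuous f ->
  (forall x : R, is_derive x 1 F (f x)) -> cint f = F (pi *+ 2) - F 0.
Proof.
move=> fc Ff; have Fc := is_derive_continuous Ff.
rewrite /cint /Rintegral (@continuous_FTC2 _ f F) ?pi2_gt0//.
- exact: continuous_subspaceT.
- split; first by move=> x _; have [] := Ff x.
    by apply: cvg_at_right_filter; exact: Fc.
  by apply: cvg_at_left_filter; exact: Fc.
- by move=> x _; rewrite derive1E; have [_ ->] := Ff x.
Qed.

Lemma cint_parts (F G f g : R -> R) : continuous f -> continuous g ->
  (forall x : R, is_derive x 1 F (f x)) -> (forall x : R, is_derive x 1 G (g x)) ->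
  F (pi *+ 2) * G (pi *+ 2) = F 0 * G 0 ->
  cint (fun x => F x * g x) = - cint (fun x => f x * G x).
Proof.
move=> fc gc Ff Gg FG.
have Fc := is_derive_continuous Ff; have Gc := is_derive_continuous Gg.
have c1 : continuous (fun x => f x * G x).
  exact: continuous_mul.
have c2 : continuous (fun x => F x * g x).
  exact: continuous_mul.
apply/eqP; rewrite -addr_eq0 addrC -cintD//; apply/eqP.
have dFG (x : R) :
    is_derive x 1 (fun x => F x * G x) (f x * G x + F x * g x).
  exact: is_derive_mul.
have c12 : continuous (fun x => f x * G x + F x * g x).
  exact: continuous_add.
by rewrite (cint_derive c12 dFG) FG subrr.
Qed.

Lemma cint_is_derive (G G' : R -> R -> R) a b t C :
  t \in `]a, b[ ->
  (forall s : R, s \in `]a, b[ -> continuous (G s)) ->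
  (forall s x : R, s \in `]a, b[ -> is_derive s 1 (G ^~ x) (G' s x)) ->
  (forall s x : R, s \in `]a, b[ -> `|G' s x| <= C) ->
  is_derive t 1 (fun s => cint (G s)) (cint (G' t)).
Proof.
move=> tab Gc GG' G'C.
have C0 : 0 <= C by apply: le_trans (G'C t 0 tab).
have P s x : s \in `]a, b[ -> partial1of2 G s x = G' s x.
  by move=> sab; rewrite partial1of2E; have [_ ->] := GG' s x sab.
have -> : cint (G' t) = cint (fun x => partial1of2 G ^~ x t).
  by apply: eq_Rintegral => x _; rewrite P.
have I1 s : `]a, b[%classic s ->
    (@lebesgue_measure R).-integrable `[0, pi *+ 2] (EFin \o G s).
  by move=> sab; exact/cint_integrable/Gc.
have I2 s x : `]a, b[%classic s -> `[0, pi *+ 2]%classic x -> derivable (G ^~ x) s 1.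
  by move=> sab _; have [] := GG' s x sab.
have I3 : (@lebesgue_measure R).-integrable `[0, pi *+ 2] (EFin \o (fun=> C)).
  exact/cint_integrable/continuous_const.
have I4 s x : `]a, b[%classic s -> `[0, pi *+ 2]%classic x ->
    `|partial1of2 G s x| <= C.
  by move=> sab _; rewrite P// G'C.
apply: DeriveDef.
  exact: (derivable_under_integral _ tab I1 I2 (fun=> C0) I3 I4).
rewrite -derive1E.
exact: (differentiation_under_integral _ tab I1 I2 (fun=> C0) I3 I4).
Qed.

End CircleIntegral.

(** * Polar coordinates in the plane *)

(** The basis vectors are locked: two partial derivatives of a function must not
    be compared by computing the entries of the vectors. *)
HB.lock Definition e1 {R : realType} : 'cV[R]_(1 + 1) := delta_mx 0 0.
HB.lock Definition e2 {R : realType} : 'cV[R]_(1 + 1) := delta_mx ord_max 0.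

Section Plane.
Context {R : realType}.
Local Notation plane := 'cV[R]_(1 + 1).

Lemma plane_decomp (z : plane) : z = z 0 0 *: e1 + z ord_max 0 *: e2.
Proof.
rewrite e1.unlock e2.unlock; apply/matrixP => i j.
rewrite !mxE !ord1 eqxx !andbT.
case: (unliftP ord0 i) => [k|] ->; last by rewrite eqxx/= mulr1 mulr0 addr0.
rewrite [k]ord1 (_ : lift ord0 0 = ord_max); last exact/val_inj.
by rewrite eqxx/= mulr0 mulr1 add0r.
Qed.

Lemma Jst_e1 : Jst R 1 *m e1 = e2.
Proof.
rewrite e1.unlock e2.unlock -colE; apply/matrixP => i j; rewrite !mxE ord1 eqxx andbT.
case: (unliftP ord0 i) => [k|] ->.
  rewrite [k]ord1.
  case: splitP => l /=; first by rewrite [l]ord1.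
  by rewrite [l]ord1 !mxE => _; case: splitP => l' //; rewrite [l']ord1 !mxE.
case: splitP => l /=; last by rewrite [l]ord1.
by rewrite [l]ord1 !mxE => _; case: splitP => l' //; rewrite [l']ord1 !mxE.
Qed.

Lemma Jst_e2 : Jst R 1 *m e2 = - e1.
Proof.
rewrite e1.unlock e2.unlock -colE; apply/matrixP => i j; rewrite !mxE ord1 eqxx andbT.
case: (unliftP ord0 i) => [k|] ->.
  rewrite [k]ord1; case: splitP => l /=; first by rewrite [l]ord1.
  rewrite [l]ord1 !mxE => _; case: splitP => l'; first by rewrite [l']ord1.
  by rewrite !mxE oppr0.
case: splitP => l /=; last by rewrite [l]ord1.
rewrite [l]ord1 !mxE => _; case: splitP => l'; first by rewrite [l']ord1.
by rewrite [l']ord1 !mxE.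
Qed.

Lemma enorm_plane (a b : R) : enorm (a *: e1 + b *: e2) = Num.sqrt (a ^+ 2 + b ^+ 2).
Proof.
rewrite /enorm e1.unlock e2.unlock; congr Num.sqrt.
rewrite big_ord_recl big_ord1 !mxE/=.
by rewrite !mulr1 !mulr0 addr0 add0r.
Qed.

Lemma plane_coord_le (z : plane) : `|z 0 0| <= enorm z /\ `|z ord_max 0| <= enorm z.
Proof.
rewrite {2 4}[z]plane_decomp enorm_plane -!sqrtr_sqr.
by split; rewrite ler_wsqrtr// ?lerDl ?lerDr sqr_ge0.
Qed.

Lemma plane_entry_le (z : plane) i : `|z i 0| <= enorm z.
Proof.
have [z1 z2] := plane_coord_le z.
case: (unliftP ord0 i) => [k|] ->//.
by rewrite [k]ord1 (_ : lift ord0 0 = ord_max) //; exact/val_inj.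
Qed.

Lemma normr_le_enorm (z : plane) : `|z| <= enorm z.
Proof.
rewrite /Num.Def.normr/= mx_normrE; apply: bigmax_le; first exact: enorm_ge0.
by move=> [i j] _; rewrite ord1/= plane_entry_le.
Qed.

Definition disc (z0 : plane) (rho : R) : set plane := [set z | enorm (z - z0) < rho].

Lemma near_disc (z0 : plane) (P : plane -> Prop) :
  (\forall z \near z0, P z) -> exists2 rho, 0 < rho & forall z, disc z0 rho z -> P z.
Proof.
move/nbhs_normP => -[rho /= rho0 H]; exists rho => // z dz; apply: H => /=.
by rewrite (le_lt_trans (normr_le_enorm _))// enormBC.
Qed.

Lemma enorm_sub_continuous (z0 : plane) : continuous (fun z : plane => enorm (z - z0)).
Proof.
move=> z; have zc : {for z, continuous (fun z : plane => z - z0)}.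
  by apply: continuousB; [exact: cvg_id|exact: cst_continuous].
exact: (continuous_comp zc (@enorm_continuous _ _ _)).
Qed.

Lemma disc_open z0 rho : open (disc z0 rho).
Proof.
rewrite (_ : disc z0 rho = (fun z : plane => enorm (z - z0)) @^-1` [set r | r < rho])//.
by apply: open_comp; [move=> z _; exact: enorm_sub_continuous|exact: open_lt].
Qed.

Lemma Delta_open : open (@Delta R).
Proof.
rewrite (_ : Delta = disc 0 1); first exact: disc_open.
by apply/funext => z; rewrite /Delta /eball/disc/= subr0.
Qed.

(** Transposition reduces the claim to closed bounded sets of row vectors. *)
Lemma closed_disc_compact (z0 : plane) d : compact [set z : plane | enorm (z - z0) <= d].
Proof.
pose tr (x : 'rV[R]_(1 + 1)) : plane := x^T.
have trc : continuous tr.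
  have lc (v : plane) (f : 'rV[R]_(1 + 1) -> R) x : {for x, continuous f} ->
      {for x, continuous (fun y => f y *: v)}.
    by move=> fc; exact: (continuous_comp fc (@scalel_continuous _ _ _ _)).
  have -> : tr = (fun x => x 0 0 *: e1 + x 0 ord_max *: e2).
    by apply/funext => x; rewrite [LHS]plane_decomp !mxE.
  by move=> x; apply: (@continuousD _ _ _ (fun x : 'rV[R]_(1 + 1) => x 0 0 *: e1)); apply: lc;
    exact: coord_continuous.
pose A' := tr @^-1` [set z : plane | enorm (z - z0) <= d].
rewrite (_ : [set z | _] = tr @` A'); last first.
  apply/seteqP; split => [z zd|_ [x xA <-]//].
  by exists z^T; rewrite /A' /tr/= trmxK.
apply: continuous_compact; first exact: continuous_subspaceT.
apply: bounded_closed_compact.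
  exists (d + enorm z0); split; first exact: num_real.
  move=> M HM x; rewrite /A'/= => xd; apply: ltW; apply: le_lt_trans HM.
  have trx : enorm (tr x) <= d + enorm z0.
    by rewrite -[tr x](subrK z0) (le_trans (enormD _ _))// lerD2r.
  rewrite /Num.Def.normr/= mx_normrE; apply: bigmax_le.
    exact: le_trans (enorm_ge0 _) trx.
  move=> [i j] _ /=; apply: le_trans trx.
  have -> : x i j = tr x j i by rewrite mxE.
  by rewrite [i]ord1 plane_entry_le.
rewrite (_ : A' = (fun x : 'rV[R]_(1 + 1) => enorm (tr x - z0)) @^-1` [set r | r <= d])//.
apply: preimage_closed; last exact: closed_le.
move=> x _; exact: (continuous_comp (trc x) (@enorm_sub_continuous _ _)).
Qed.

(** cis t is the complex number e^(it), and cisd t is i e^(it). *)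
Definition cis (t : R) : plane := cos t *: e1 + sin t *: e2.
Definition cisd (t : R) : plane := - sin t *: e1 + cos t *: e2.
Definition circ (z0 : plane) (r t : R) := z0 + r *: cis t.

Lemma enorm_cis t : enorm (cis t) = 1.
Proof. by rewrite enorm_plane cos2Dsin2 sqrtr1. Qed.

Lemma enorm_cisd t : enorm (cisd t) = 1.
Proof. by rewrite enorm_plane sqrrN addrC cos2Dsin2 sqrtr1. Qed.

Lemma Jst_cis t : Jst R 1 *m cis t = cisd t.
Proof.
by rewrite /cis mulmxDr -!scalemxAr Jst_e1 Jst_e2 /cisd scalerN addrC scaleNr.
Qed.

Lemma circ_disc z0 r t : enorm (circ z0 r t - z0) = `|r|.
Proof. by rewrite /circ addrAC subrr add0r enormZ enorm_cis mulr1. Qed.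

Lemma circ0 z0 t : circ z0 0 t = z0.
Proof. by rewrite /circ scale0r addr0. Qed.

Lemma circ_2pi z0 r : circ z0 r (pi *+ 2) = circ z0 r 0.
Proof. by rewrite /circ /cis cos2pi sin2pi cos0 sin0. Qed.

Lemma is_derive_scale (V : normedModType R) (f : R -> R) (w : V) (t df : R) :
  is_derive t 1 f df -> is_derive t 1 (fun s => f s *: w) (df *: w).
Proof.
move=> fd; have lin : linear (fun a : R => a *: w : V).
  by move=> a x y; rewrite scalerDl scalerA.
by apply: (is_derive_linear lin _ fd) => x; exact: scalel_continuous.
Qed.

Lemma is_derive_cis (t : R) : is_derive t 1 cis (cisd t).
Proof. by apply: is_deriveD; apply: is_derive_scale. Qed.

Lemma is_derive_circ_angle z0 (r t : R) :
  is_derive t 1 (circ z0 r) (r *: cisd t).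
Proof.
apply: (is_derive_eq (is_deriveD (is_derive_cst z0 t 1) (is_deriveZ r (is_derive_cis t)))).
by rewrite add0r.
Qed.

Lemma is_derive_circ_radius z0 (r t : R) :
  is_derive r 1 (fun s => circ z0 s t) (cis t).
Proof.
have H := is_derive_scale (cis t) (is_derive_id r (1 : R)).
by apply: (is_derive_eq (is_deriveD (is_derive_cst z0 r 1) H)); rewrite add0r scale1r.
Qed.

Lemma circ_continuous z0 r : continuous (circ z0 r).
Proof.
move=> t; apply: differentiable_continuous; apply/derivable1_diffP.
by have [] := is_derive_circ_angle z0 r t.
Qed.

Section Along.
Variables (W : normedModType R) (F : plane -> W).

Lemma diff_plane z v : differentiable F z ->
  'd F z v = v 0 0 *: 'D_e1 F z + v ord_max 0 *: 'D_e2 F z.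
Proof.
by move=> Fz; rewrite {1}[v]plane_decomp linearD !linearZ !deriveE.
Qed.

Lemma diff_cis z t : differentiable F z ->
  'd F z (cis t) = cos t *: 'D_e1 F z + sin t *: 'D_e2 F z.
Proof. by move=> Fz; rewrite /cis linearD !linearZ !deriveE. Qed.

Lemma diff_cisd z t : differentiable F z ->
  'd F z (cisd t) = - sin t *: 'D_e1 F z + cos t *: 'D_e2 F z.
Proof. by move=> Fz; rewrite /cisd linearD !linearZ !deriveE. Qed.

Lemma is_derive_along_angle z0 (r t : R) : differentiable F (circ z0 r t) ->
  is_derive t 1 (fun s => F (circ z0 r s)) (r *: 'd F (circ z0 r t) (cisd t)).
Proof.
move=> Fd; have := is_derive_curve Fd (is_derive_circ_angle z0 r t).
by rewrite linearZ.
Qed.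

Lemma is_derive_along_radius z0 (r t : R) : differentiable F (circ z0 r t) ->
  is_derive r 1 (fun s => F (circ z0 s t)) ('d F (circ z0 r t) (cis t)).
Proof.
move=> Fd; exact: (is_derive_curve (g := fun s => circ z0 s t))
  (is_derive_circ_radius z0 r t).
Qed.

Lemma continuous_along z0 r t : {for circ z0 r t, continuous F} ->
  {for t, continuous (fun s => F (circ z0 r s))}.
Proof. exact: (continuous_comp (@circ_continuous z0 r t)). Qed.

End Along.

End Plane.

(** * Stokes' formula on small circles *)

Section Green.
Context {R : realType}.
Local Notation plane := 'cV[R]_(1 + 1).

Lemma continuous_quad (a b c : R) :
  continuous (fun t => a * cos t ^+ 2 + b * sin t ^+ 2 + c * (sin t * cos t)).
Proof.
have cc := continuous_const.
have c2 (f : R -> R) : continuous f -> continuous (fun t => f t ^+ 2).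
  by move=> fc t; exact: continuous_sqr (fc t).
have cC := @continuous_cos R; have cS := @continuous_sin R.
apply: continuous_add; last by apply: continuous_mul => //; exact: continuous_mul.
by apply: continuous_add; apply: continuous_mul => //; exact: c2.
Qed.

Lemma cint_quad (a b c : R) :
  cint (fun t => a * cos t ^+ 2 + b * sin t ^+ 2 + c * (sin t * cos t))
  = pi * (a + b).
Proof.
pose sc t : R := sin t * cos t.
have dsc (t : R) : is_derive t 1 sc (cos t ^+ 2 - sin t ^+ 2).
  apply: (is_derive_eq (is_derive_mul (is_derive_sin t) (is_derive_cos t))).
  by rewrite mulrN !expr2.
have dss (t : R) : is_derive t 1 (fun t => sin t * sin t) (2 * (sin t * cos t)).
  apply: (is_derive_eq (is_derive_mul (is_derive_sin t) (is_derive_sin t))).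
  by ring.
pose F t : R := (t + sc t) * (a / 2) + (t - sc t) * (b / 2)
                + sin t * sin t * (c / 2).
have dF (t : R) : is_derive t 1 F
    (a * cos t ^+ 2 + b * sin t ^+ 2 + c * (sin t * cos t)).
  have dtp : is_derive t 1 (fun t => t + sc t) (1 + (cos t ^+ 2 - sin t ^+ 2)).
    exact: is_deriveD.
  have dtm : is_derive t 1 (fun t => t - sc t) (1 - (cos t ^+ 2 - sin t ^+ 2)).
    exact: is_deriveB.
  apply: (is_derive_eq (is_deriveD (is_deriveD (is_derive_mulr (a / 2) dtp)
     (is_derive_mulr (b / 2) dtm)) (is_derive_mulr (c / 2) (dss t)))).
  have := cos2Dsin2 t; set x := cos t; set y := sin t => xy.
  have -> : y ^+ 2 = 1 - x ^+ 2 by rewrite -xy addrAC subrr add0r.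
  by field.
rewrite (cint_derive (@continuous_quad a b c) dF).
by rewrite /F /sc sin2pi cos2pi sin0 cos0; field.
Qed.

Lemma norm_trig (a b t : R) : `|cos t * a + sin t * b| <= `|a| + `|b|.
Proof.
rewrite (le_trans (ler_normD _ _))// !normrM lerD// ler_piMl//.
  exact: cos_max.
exact: sin_max.
Qed.

Lemma norm_trig' (a b t : R) : `|- sin t * a + cos t * b| <= `|a| + `|b|.
Proof.
rewrite (le_trans (ler_normD _ _))// !normrM normrN lerD// ler_piMl//.
  exact: sin_max.
exact: cos_max.
Qed.

Lemma polar_product_estimate (e r t B b1 b2 h1 h2 y1 y2 : R) :
  0 < e -> e <= 1 -> 0 < r ->
  `|B - r * (cos t * b1 + sin t * b2)| <= e * r ->
  `|y1 - h1| <= e -> `|y2 - h2| <= e ->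
  `|B * (- sin t * y1 + cos t * y2)
     - r * (cos t * b1 + sin t * b2) * (- sin t * h1 + cos t * h2)|
  <= e * (`|h1| + `|h2| + 2 + 2 * (`|b1| + `|b2|)) * r.
Proof.
move=> e0 e1 r0 db d1 d2.
have -> : B * (- sin t * y1 + cos t * y2)
   - r * (cos t * b1 + sin t * b2) * (- sin t * h1 + cos t * h2)
  = (B - r * (cos t * b1 + sin t * b2)) * (- sin t * y1 + cos t * y2)
    + r * (cos t * b1 + sin t * b2)
      * (- sin t * (y1 - h1) + cos t * (y2 - h2)) by ring.
have y1n : `|y1| <= `|h1| + e.
  by rewrite -[y1](subrK h1) (le_trans (ler_normD _ _))// addrC lerD2l.
have y2n : `|y2| <= `|h2| + e.
  by rewrite -[y2](subrK h2) (le_trans (ler_normD _ _))// addrC lerD2l.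
have T1 := norm_trig' y1 y2 t.
have T2 := norm_trig b1 b2 t.
have T3 := norm_trig' (y1 - h1) (y2 - h2) t.
rewrite (le_trans (ler_normD _ _))// !normrM (gtr0_norm r0).
have -> : e * (`|h1| + `|h2| + 2 + 2 * (`|b1| + `|b2|)) * r
  = e * r * (`|h1| + `|h2| + 2) + r * (`|b1| + `|b2|) * (2 * e) by ring.
apply: lerD; apply: ler_pM => //.
- by apply: (le_trans T1); lra.
- by rewrite mulr_ge0// ltW.
- by rewrite ler_pM2l.
- by apply: (le_trans T3); lra.
Qed.

Section OnDisc.
Variables (z0 : plane) (rho : R) (F : plane -> R).
Hypothesis F1 : C1_on (disc z0 rho) F.

Lemma circ_in r t : `|r| < rho -> disc z0 rho (circ z0 r t).
Proof. by rewrite /disc/= circ_disc. Qed.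

Lemma C1_on_continuous z : disc z0 rho z -> {for z, continuous F}.
Proof. by move=> dz; apply: differentiable_continuous; exact: F1.1. Qed.

Lemma continuous_circ r : `|r| < rho -> continuous (fun t => F (circ z0 r t)).
Proof.
by move=> r1 t; apply: continuous_along; apply: C1_on_continuous; exact: circ_in.
Qed.

Lemma continuous_derive_circ r v t : `|r| < rho ->
  {for t, continuous (fun t => 'D_v F (circ z0 r t))}.
Proof.
move=> r1; apply: (@continuous_along _ _ ('D_v F)).
exact: F1.2 (circ_in t r1).
Qed.

Lemma continuous_diff_cis r : `|r| < rho ->
  continuous (fun t => 'd F (circ z0 r t) (cis t)).
Proof.
move=> r1; rewrite (_ : (fun t => _) = (fun t =>
    cos t * 'D_e1 F (circ z0 r t) + sin t * 'D_e2 F (circ z0 r t))); last first.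
  by apply/funext => t; rewrite diff_cis//; apply: F1.1; exact: circ_in.
move=> t; apply: (@continuousD _ _ _ (fun t => cos t * 'D_e1 F (circ z0 r t)));
  apply: continuousM; try exact: continuous_cos; try exact: continuous_sin;
  exact: continuous_derive_circ.
Qed.

Lemma continuous_diff_cisd r : `|r| < rho ->
  continuous (fun t => 'd F (circ z0 r t) (cisd t)).
Proof.
move=> r1; rewrite (_ : (fun t => _) = (fun t =>
    - sin t * 'D_e1 F (circ z0 r t) + cos t * 'D_e2 F (circ z0 r t))); last first.
  by apply/funext => t; rewrite diff_cisd//; apply: F1.1; exact: circ_in.
move=> t; apply: (@continuousD _ _ _ (fun t => - sin t * 'D_e1 F (circ z0 r t)));
  apply: continuousM; try exact: continuous_cos;
  try (apply: continuousN; exact: continuous_sin);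
  exact: continuous_derive_circ.
Qed.

Lemma cint_circ_is_derive C (r : R) : `|r| < rho ->
  (forall z, disc z0 rho z -> `|'D_e1 F z| <= C /\ `|'D_e2 F z| <= C) ->
  is_derive r 1 (fun s => cint (fun t => F (circ z0 s t)))
    (cint (fun t => 'd F (circ z0 r t) (cis t))).
Proof.
move=> r1 FC.
have itvE s : (s \in `]- rho, rho[) = (`|s| < rho) by rewrite in_itv/= ltr_norml.
apply: (@cint_is_derive _ (fun s t => F (circ z0 s t))
  (fun s t => 'd F (circ z0 s t) (cis t)) (- rho) rho r (C + C)).
- by rewrite itvE.
- by move=> s; rewrite itvE; exact: continuous_circ.
- move=> s t; rewrite itvE => s1; apply: is_derive_along_radius.
  by apply: F1.1; exact: circ_in.
- move=> s t; rewrite itvE => s1; have Ds := circ_in t s1.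
  rewrite diff_cis; last exact: F1.1.
  rewrite (le_trans (norm_trig _ _ _))//.
  by have [FC1 FC2] := FC _ Ds; exact: lerD FC1 FC2.
Qed.

Lemma cint_diff_cisd r : `|r| < rho -> r != 0 ->
  cint (fun t => 'd F (circ z0 r t) (cisd t)) = 0.
Proof.
move=> r1 r0; have Fc := continuous_diff_cisd r1.
apply: (mulfI r0); rewrite mulr0 -cintZ//.
have dF (t : R) : is_derive t 1 (fun t => F (circ z0 r t))
    (r * 'd F (circ z0 r t) (cisd t)).
  by apply: is_derive_along_angle; apply: F1.1; exact: circ_in.
have rFc : continuous (fun t => r * 'd F (circ z0 r t) (cisd t)).
  by apply: continuous_mul => //; exact: continuous_const.
by rewrite (cint_derive rFc dF) circ_2pi subrr.
Qed.

End OnDisc.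

Lemma diff_eps (V : normedModType R) (f : V -> R) x (e : R) : 0 < e ->
  differentiable f x ->
  \forall y \near x, `|f y - f x - 'd f x (y - x)| <= e * `|y - x|.
Proof.
move=> e0 fx; have /eqaddoP/(_ e e0) := diff_locally fx.
move=> H; apply/nbhs0P; apply: filterS H => v.
rewrite /= -[X in `|X|]/(f (v + x) - (f x + 'd f x v)).
by rewrite [x + v]addrC addrK opprD addrA.
Qed.

Lemma C1_on_shrink (A : set plane) (F : plane -> R) z0 : open A -> A z0 ->
  C1_on A F -> exists rho C, [/\ 0 < rho, disc z0 rho `<=` A &
    forall z, disc z0 rho z -> `|'D_e1 F z| <= C /\ `|'D_e2 F z| <= C].
Proof.
move=> oA Az0 [Fd Fc].
pose C := Num.max (`|'D_e1 F z0| + 1) (`|'D_e2 F z0| + 1).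
have bnd v : \forall z \near z0, `|'D_v F z| <= `|'D_v F z0| + 1.
  have /cvgrPdist_le/(_ _ ltr01) := Fc v z0 Az0; apply: filterS => z.
  rewrite distrC => ?; rewrite -[X in `|X|](subrK ('D_v F z0)).
  by rewrite (le_trans (ler_normD _ _))// addrC lerD2l.
have [rho rho0 H] := near_disc (filterI (near_open oA Az0 (fun z Az => Az))
  (filterI (bnd e1) (bnd e2))).
exists rho, C; split=> [//|z /H[]//|z /H[_ [h1 h2]]].
have C1 : `|'D_e1 F z0| + 1 <= C by rewrite le_max lexx.
have C2 : `|'D_e2 F z0| + 1 <= C by rewrite le_max lexx orbT.
by split; [exact: le_trans h1 C1|exact: le_trans h2 C2].
Qed.

Lemma C1_on_sub (A B : set plane) (F : plane -> R) : B `<=` A ->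
  C1_on A F -> C1_on B F.
Proof. by move=> BA [Fd Fc]; split => [z /BA|v z /BA]; [exact: Fd|exact: Fc]. Qed.

(** Stokes' formula for the form b dH on an infinitesimal disc.  Since dH is
    exact, b may be replaced by b - b z0, which on the circle of radius r is
    linear up to o(r); and dH is constant up to o(1).  Hence the integrand is a
    quadratic trigonometric polynomial up to o(r), and no second derivative of
    H is involved: this is what permits to work with discs of class C^1. *)
Lemma infinitesimal_stokes (A : set plane) (b H : plane -> R) z0 (eta : R) :
  open A -> A z0 -> (forall z, A z -> {for z, continuous b}) ->
  differentiable b z0 -> C1_on A H -> 0 < eta ->
  exists2 r0, 0 < r0 & forall r, 0 < r < r0 ->
   `|cint (fun t => (b (circ z0 r t) - b z0) * 'd H (circ z0 r t) (cisd t))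
     - pi * ('D_e1 b z0 * 'D_e2 H z0 - 'D_e2 b z0 * 'D_e1 H z0) * r| <= eta * r.
Proof.
move=> oA Az0 bc bd H1 eta0.
(* Only the values of the partial derivatives at z0 matter below. *)
have [b1 b1E] : exists x : R, x = 'D_e1 b z0 by eexists.
have [b2 b2E] : exists x : R, x = 'D_e2 b z0 by eexists.
have [h1 h1E] : exists x : R, x = 'D_e1 H z0 by eexists.
have [h2 h2E] : exists x : R, x = 'D_e2 H z0 by eexists.
rewrite -b1E -b2E -h1E -h2E.
pose K := `|h1| + `|h2| + 2 + 2 * (`|b1| + `|b2|).
have K0 : 0 < K by rewrite ltr_wpDr ?ltr_wpDl ?mulr_ge0 ?addr_ge0.
pose e := Num.min 1 (eta / (pi *+ 2 * K)).
have piK0 : 0 < pi *+ 2 * K :> R by rewrite mulr_gt0// pi2_gt0.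
have e0 : 0 < e by rewrite lt_min ltr01 divr_gt0.
have e1' : e <= 1 by rewrite ge_min lexx.
have eK : e * K * (pi *+ 2) <= eta.
  by rewrite -mulrA (mulrC K) -ler_pdivlMr// ge_min lexx orbT.
have Hc v : \forall z \near z0, `|'D_v H z - 'D_v H z0| <= e.
  have /cvgrPdist_le/(_ _ e0) := H1.2 v z0 Az0; apply: filterS => z.
  by rewrite distrC.
have [r0 r00 P] := near_disc (filterI (near_open oA Az0 (fun z Az => Az))
  (filterI (filterI (Hc e1) (Hc e2)) (diff_eps e0 bd))).
exists r0 => // r /andP[rp rr0].
have ar : `|r| < r0 by rewrite gtr0_norm.
have Pc t : disc z0 r0 (circ z0 r t) by rewrite /disc/= circ_disc.
have H1' : C1_on (disc z0 r0) H by apply: C1_on_sub H1 => z /P[].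
have bcc : continuous (fun t => b (circ z0 r t)).
  by move=> t; apply: continuous_along; apply: bc; case: (P _ (Pc t)).
pose q0 t := b1 * h2 * cos t ^+ 2 + (- (b2 * h1)) * sin t ^+ 2
             + (b2 * h2 - b1 * h1) * (sin t * cos t).
have q0c : continuous q0 by exact: continuous_quad.
have -> : pi * (b1 * h2 - b2 * h1) * r = cint (fun t => r * q0 t).
  by rewrite cintZ// cint_quad mulrC.
have rq0c : continuous (fun t => r * q0 t).
  by apply: continuous_mul => //; exact: continuous_const.
have bHc : continuous (fun t =>
    (b (circ z0 r t) - b z0) * 'd H (circ z0 r t) (cisd t)).
  apply: continuous_mul; last exact: (continuous_diff_cisd H1' ar).
  by apply: continuous_sub => //; exact: continuous_const.
rewrite -cintB//.
apply: (@le_trans _ _ (e * K * r * (pi *+ 2))); last first.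
  by rewrite mulrAC ler_pM2r.
apply: cint_norm_le; first exact: continuous_sub.
move=> t; have [Az [[d1 d2] db]] := P _ (Pc t).
rewrite diff_cisd; last exact: H1.1.
have dz : circ z0 r t - z0 = r *: cis t by rewrite /circ addrAC subrr add0r.
have nr : `|r *: cis t| <= r.
  by rewrite (le_trans (normr_le_enorm _))// enormZ enorm_cis mulr1 gtr0_norm.
move: db; rewrite dz linearZ (diff_cis _ bd) -b1E -b2E => db.
have {nr}db := le_trans db (ler_wpM2l (ltW e0) nr).
rewrite -h1E in d1; rewrite -h2E in d2.
have -> : r * q0 t = r * (cos t * b1 + sin t * b2) * (- sin t * h1 + cos t * h2).
  by rewrite /q0; ring.
exact: polar_product_estimate.
Qed.

End Green.

(** * Circle means and the maximum principle *)

Section MaximumPrinciple.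
Context {R : realType}.
Local Notation plane := 'cV[R]_(1 + 1).

(** A one-sided Laplacian in the sense of Blaschke and Privalov.  When psi is of
    class C^2, its integral over the circle of radius r is
    2 pi psi z0 + (pi / 2) (Laplacian of psi at z0) r^2 + o(r^2), so that L is
    a lower bound for pi / 2 times the Laplacian.  This makes sense for
    functions that are not twice differentiable, such as the composition of a
    C^2 function with a C^1 disc. *)
Definition circle_lapl_ge (psi : plane -> R) z0 (L : R) := forall eta, 0 < eta ->
  exists2 r0, 0 < r0 & forall r, 0 < r < r0 ->
    (L - eta) * r ^+ 2 <= cint (fun t => psi (circ z0 r t)) - psi z0 * (pi *+ 2).

Lemma quadratic_growth (I I' : R -> R) (a r : R) : 0 < r ->
  (forall s, 0 <= s <= r -> is_derive s 1 I (I' s)) ->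
  (forall s, 0 < s < r -> a * s <= I' s) ->
  a / 2 * r ^+ 2 <= I r - I 0.
Proof.
move=> r0 dI aI.
pose g s := I s - a / 2 * (s * s).
have dg s : 0 <= s <= r -> is_derive s 1 g (I' s - a * s).
  move=> s0r; have dss := is_derive_mul (is_derive_id s (1 : R)) (is_derive_id s (1 : R)).
  apply: (is_derive_eq (is_deriveB (dI s s0r) (is_deriveZ (a / 2) dss))).
  by rewrite -[_ *: _]/(_ * _) mul1r mulr1; field.
have gc : {within `[0, r], continuous g}.
  apply: derivable_within_continuous => s; rewrite in_itv/= => /dg.
  by case.
have dg' s : s \in `]0, r[ -> is_derive s 1 g (I' s - a * s).
  by rewrite in_itv/= => /andP[s0 sr]; apply: dg; rewrite !ltW.
have [c] := MVT r0 dg' gc; rewrite in_itv/= => cr.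
rewrite /g !mul0r mulr0 !subr0 -expr2 => gE.
have : 0 <= (I' c - a * c) * r
  by apply: mulr_ge0; [rewrite subr_ge0 aI|rewrite ltW].
by rewrite -gE; lra.
Qed.

Lemma common_radius n (P : 'I_n -> R -> Prop) :
  (forall k, exists2 r0, 0 < r0 & forall r, 0 < r < r0 -> P k r) ->
  exists2 r0, 0 < r0 & forall r, 0 < r < r0 -> forall k, P k r.
Proof.
move=> H; have [/= f fP] := choice (fun k => let: ex_intro2 r p q := H k in
  ex_intro (fun r0 => 0 < r0 /\ forall r, 0 < r < r0 -> P k r) r (conj p q)).
exists (\big[Num.min/1]_k f k).
  by apply: lt_bigmin => // k _; case: (fP k).
move=> r /andP[r0 rf] k; have [_] := fP k; apply; rewrite r0/=.
by apply: (lt_le_trans rf); exact: bigmin_le_cond.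
Qed.

(** The hypothesis on phi says that the form sum_k b_k dH_k is d^c phi.  The
    derivative with respect to r of the integral of phi over the circle is
    1 / r times the integral of this form over the circle, which
    infinitesimal_stokes computes up to o(r). *)
Lemma circle_lapl_stokes n (A : set plane) (phi : plane -> R)
    (b H : 'I_n -> plane -> R) z0 :
  open A -> A z0 -> C1_on A phi ->
  (forall k z, A z -> {for z, continuous (b k)}) ->
  (forall k, differentiable (b k) z0) ->
  (forall k, C1_on A (H k)) ->
  (forall z t, A z ->
    'd phi z (cis t) = \sum_k b k z * 'd (H k) z (cisd t)) ->
  circle_lapl_ge phi z0 (pi / 2 *
    \sum_k ('D_e1 (b k) z0 * 'D_e2 (H k) z0 - 'D_e2 (b k) z0 * 'D_e1 (H k) z0)).
Proof.
move=> oA Az0 phi1 bc bd H1 dphi eta eta0.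
set L := \sum_k _.
have [rho [C [rho0 dA phiC]]] := C1_on_shrink oA Az0 phi1.
have phi1' := C1_on_sub dA phi1.
pose e := 2 * eta / n.+1%:R.
have e0 : 0 < e by rewrite !mulr_gt0// invr_gt0 ltr0n.
have [r1 r10 P] := common_radius (fun k =>
  infinitesimal_stokes oA Az0 (bc k) (bd k) (H1 k) e0).
exists (Num.min r1 rho); first by rewrite lt_min r10.
move=> r; rewrite lt_min => /and3P[rp rr1 rrho].
pose I s := cint (fun t => phi (circ z0 s t)).
have I0 : I 0 = phi z0 * (pi *+ 2).
  rewrite -cint_cst; congr cint; apply/funext => t; by rewrite circ0.
rewrite -I0.
have -> : pi / 2 * L - eta = (pi * L - 2 * eta) / 2 by field.
apply: (quadratic_growth rp (I' := fun s => cint (fun t => 'd phi (circ z0 s t) (cis t)))).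
  move=> s /andP[s0 sr]; apply: (cint_circ_is_derive phi1' _ phiC).
  by rewrite ger0_norm// (le_lt_trans sr).
move=> s /andP[s0 sr].
have srho : `|s| < rho by rewrite gtr0_norm// (lt_trans sr).
have Hk k := C1_on_sub dA (H1 k).
have cH k : continuous (fun t => 'd (H k) (circ z0 s t) (cisd t)).
  exact: (continuous_diff_cisd (Hk k) srho).
have cb k : continuous (fun t => b k (circ z0 s t)).
  by move=> t; apply: continuous_along; apply/bc/dA; exact: circ_in.
have -> : cint (fun t => 'd phi (circ z0 s t) (cis t)) =
   \sum_k cint (fun t => (b k (circ z0 s t) - b k z0) * 'd (H k) (circ z0 s t) (cisd t)).
  transitivity (\sum_k cint (fun t => b k (circ z0 s t) * 'd (H k) (circ z0 s t) (cisd t))).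
    rewrite -cint_sum; last by move=> k; exact: continuous_mul.
    congr cint; apply/funext => t; rewrite dphi//.
    by apply: dA; exact: circ_in.
  apply: eq_bigr => k _.
  have cc : continuous (fun t => b k z0 * 'd (H k) (circ z0 s t) (cisd t)).
    by apply: continuous_mul => //; exact: continuous_const.
  under [in RHS]eq_fun do rewrite mulrBl.
  rewrite cintB//; last exact: continuous_mul.
  by rewrite cintZ// (cint_diff_cisd (Hk k) srho) ?gt_eqF// mulr0 subr0.
have -> : (pi * L - 2 * eta) * s = pi * L * s - n.+1%:R * (e * s).
  have : n.+1%:R != 0 :> R by rewrite pnatr_eq0.
  by rewrite /e; move: (n.+1%:R) => N N0; field.
have es : 0 <= e * s by rewrite mulr_ge0// ltW.
apply: (@le_trans _ _ (\sum_(k < n)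
  (pi * ('D_e1 (b k) z0 * 'D_e2 (H k) z0 - 'D_e2 (b k) z0 * 'D_e1 (H k) z0) * s - e * s))).
  rewrite sumrB sumr_const card_ord -mulr_suml -mulr_sumr lerD2l lerN2.
  by rewrite mulr_natl ler_wpMn2l.
apply: ler_sum => k _.
have /P/(_ k) : 0 < s < r1 by rewrite s0 (lt_trans sr).
by rewrite ler_norml => /andP[+ _]; lra.
Qed.

Lemma circle_lapl_geD (f g : plane -> R) z0 Lf Lg rho : 0 < rho ->
  (forall z, disc z0 rho z -> {for z, continuous f}) ->
  (forall z, disc z0 rho z -> {for z, continuous g}) ->
  circle_lapl_ge f z0 Lf -> circle_lapl_ge g z0 Lg ->
  circle_lapl_ge (fun z => f z + g z) z0 (Lf + Lg).
Proof.
move=> rho0 fc gc fL gL eta eta0.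
have eta2 : 0 < eta / 2 by rewrite divr_gt0.
have [r1 r10 H1] := fL _ eta2; have [r2 r20 H2] := gL _ eta2.
exists (Num.min (Num.min r1 r2) rho); first by rewrite !lt_min r10 r20.
move=> r; rewrite !lt_min => /andP[r0 /andP[/andP[rr1 rr2] rrho]].
have ar : `|r| < rho by rewrite gtr0_norm.
rewrite cintD.
- have := H1 r; have := H2 r; rewrite r0 rr1 rr2 => /(_ isT) h2 /(_ isT) h1.
  by move: h1 h2; lra.
- by move=> t; apply: continuous_along; apply: fc; exact: circ_in.
- by move=> t; apply: continuous_along; apply: gc; exact: circ_in.
Qed.

(** At an interior maximum c the integrals over small circles around c are at
    most 2 pi psi c, which contradicts a positive Laplacian at c. *)
Lemma circle_max_principle (psi : plane -> R) zs d m : 0 < d ->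
  (forall z, enorm (z - zs) <= d -> {for z, continuous psi}) ->
  (forall z, enorm (z - zs) < d -> exists2 L, 0 < L & circle_lapl_ge psi z L) ->
  (forall z, enorm (z - zs) = d -> psi z <= m) ->
  forall z, enorm (z - zs) <= d -> psi z <= m.
Proof.
move=> d0 psic psiL psib z zd.
pose K := [set z : plane | enorm (z - zs) <= d].
have Kc : {within K, continuous psi}.
  by apply: continuous_in_subspaceT => y /set_mem; exact: psic.
have [c /set_mem cK cmax] :=
  compact_EVT_max (ex_intro K z zd) (@closed_disc_compact _ zs d) Kc.
apply: (le_trans (cmax z _)); first by rewrite inE.
have := cK; rewrite /K/= le_eqVlt => /predU1P[/psib//|cd].
exfalso; have [L L0 psL] := psiL c cd.
have [r0 r00 H] := psL _ (divr_gt0 L0 (ltr0Sn _ 1)).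
pose r := Num.min r0 (d - enorm (c - zs)) / 2.
have m0 : 0 < Num.min r0 (d - enorm (c - zs)) by rewrite lt_min r00 subr_gt0.
have rp : 0 < r by rewrite divr_gt0.
have rm : r < Num.min r0 (d - enorm (c - zs)).
  by rewrite /r ltr_pdivrMr// ltr_pMr// ltr1n.
move: (rm); rewrite lt_min => /andP[rr0 rd].
have inK t : K (circ c r t).
  rewrite /K/= (_ : circ c r t - zs = (circ c r t - c) + (c - zs)); last first.
    by rewrite addrA subrK.
  by rewrite (le_trans (enormD _ _))// circ_disc gtr0_norm// -lerBrDr ltW.
have : cint (fun t => psi (circ c r t)) <= psi c * (pi *+ 2).
  rewrite -cint_cst; apply: cint_le => [t||t].
  - by apply: continuous_along; apply: psic; exact: inK.
  - exact: continuous_const.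
  - by apply: cmax; rewrite inE; exact: inK.
have := H r; rewrite rp rr0 => /(_ isT) h1 h2.
have : 0 < (L - L / 2) * r ^+ 2 by rewrite mulr_gt0 ?exprn_gt0//; lra.
lra.
Qed.

End MaximumPrinciple.

(** * A rational barrier *)

Section Barrier.
Context {R : realType}.
Local Notation plane := 'cV[R]_(1 + 1).

(** The barrier is subharmonic outside the disc of radius s around zs, and its
    Laplacian is at least - 4 / s^2 inside; at distance of order 1 from zs it
    is of order s^2 and strictly decreasing.  Adding a multiple of it to a
    negative subharmonic function with a large Laplacian on the disc of radius
    s thus transfers the information to a fixed distance from zs, at the price
    of a factor s^2. *)
Definition barrier (s : R) (zs z : plane) : R :=
  s ^+ 2 / (s ^+ 2 + enorm (z - zs) ^+ 2).

Lemma barrier_denom_gt0 (s a : R) : 0 < s -> 0 < s ^+ 2 + a ^+ 2.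
Proof. by move=> s0; rewrite ltr_pwDl ?exprn_gt0// sqr_ge0. Qed.

Lemma barrier_continuous s zs : 0 < s -> continuous (barrier s zs).
Proof.
move=> s0 z; rewrite /barrier.
have nc : {for z, continuous (fun z : plane => enorm (z - zs) ^+ 2)}.
  exact: continuous_sqr (@enorm_sub_continuous _ zs z).
have dc : {for z, continuous (fun z : plane => s ^+ 2 + enorm (z - zs) ^+ 2)}.
  exact: (continuousD (@cst_continuous _ _ (s ^+ 2) z) nc).
apply: (continuousM (@cst_continuous _ _ (s ^+ 2) z)).
by apply: continuousV => //; rewrite gt_eqF// barrier_denom_gt0.
Qed.

Lemma inv_lower_bound (S x : R) : 0 < S -> 0 < S + x ->
  S^-1 - x / S ^+ 2 + x ^+ 2 / S ^+ 3 - x ^+ 3 / S ^+ 4 <= (S + x)^-1.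
Proof.
move=> S0 Sx; rewrite -subr_ge0.
have -> : (S + x)^-1 - (S^-1 - x / S ^+ 2 + x ^+ 2 / S ^+ 3 - x ^+ 3 / S ^+ 4)
    = x ^+ 4 / (S ^+ 4 * (S + x)).
  by field; rewrite !gt_eqF.
by rewrite divr_ge0// ?exprn_even_ge0// mulr_ge0 ?exprn_ge0 ?ltW.
Qed.

Lemma cint_trig1 (a b : R) : cint (fun t => cos t * a + sin t * b) = 0.
Proof.
have dF (t : R) : is_derive t 1 (fun t => sin t * a - cos t * b) (cos t * a + sin t * b).
  apply: (is_derive_eq (is_deriveB (is_derive_mulr a (is_derive_sin t))
    (is_derive_mulr b (is_derive_cos t)))).
  by rewrite mulNr opprK.
rewrite (cint_derive _ dF); first by rewrite sin2pi cos2pi sin0 cos0 subrr.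
by apply: continuous_add; apply: continuous_mul;
  [exact: continuous_cos|exact: continuous_const
  |exact: continuous_sin|exact: continuous_const].
Qed.

Lemma dotp_e1 (z : plane) : dotp z e1 = z 0 0.
Proof.
by rewrite /dotp e1.unlock big_ord_recl big_ord1 !mxE/= mulr1 mulr0 addr0.
Qed.

Lemma dotp_e2 (z : plane) : dotp z e2 = z ord_max 0.
Proof.
rewrite /dotp e2.unlock big_ord_recl big_ord1 !mxE/= mulr0 add0r mulr1.
by congr (z _ _); exact/val_inj.
Qed.

Lemma enorm_sqr_plane (z : plane) : enorm z ^+ 2 = dotp z e1 ^+ 2 + dotp z e2 ^+ 2.
Proof.
rewrite {1}[z]plane_decomp enorm_plane dotp_e1 dotp_e2 sqr_sqrtr//.
by rewrite addr_ge0 ?sqr_ge0.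
Qed.

Lemma enorm_sqrDZ m (v w : 'cV[R]_m) r :
  enorm (v + r *: w) ^+ 2 = enorm v ^+ 2 + 2 * r * dotp v w + r ^+ 2 * enorm w ^+ 2.
Proof.
rewrite !enorm_sqr !(dotpDr, dotpDl) !(dotpZr, dotpZl) (dotpC w v); ring.
Qed.

Lemma enorm_sqr_circ (z0 zs : plane) r t : enorm (circ z0 r t - zs) ^+ 2 =
  enorm (z0 - zs) ^+ 2
  + (r ^+ 2 + 2 * r * (cos t * dotp (z0 - zs) e1 + sin t * dotp (z0 - zs) e2)).
Proof.
have -> : circ z0 r t - zs = (z0 - zs) + r *: cis t by rewrite /circ addrAC.
rewrite enorm_sqrDZ enorm_cis expr1n mulr1 /cis dotpDr !dotpZr.
by rewrite -addrA [X in _ + X]addrC.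
Qed.

(** The squared distance to zs on the circle is a constant plus a quantity
    x = O(r), and 1 / (S + x) is bounded below by its Taylor polynomial of
    degree 3 at x = 0, whose integral is explicit up to O(r^3). *)
Lemma barrier_lapl s (zs z0 : plane) : 0 < s ->
  circle_lapl_ge (barrier s zs) z0 (2 * pi * s ^+ 2 *
     (enorm (z0 - zs) ^+ 2 - s ^+ 2) / (s ^+ 2 + enorm (z0 - zs) ^+ 2) ^+ 3).
Proof.
move=> s0 eta eta0.
set A := enorm (z0 - zs) ^+ 2; set S := s ^+ 2 + A.
have S0 : 0 < S by exact: barrier_denom_gt0.
set x1 := dotp (z0 - zs) e1; set x2 := dotp (z0 - zs) e2.
pose a t := cos t * x1 + sin t * x2.
pose al := `|x1| + `|x2|.
have al0 : 0 <= al by rewrite addr_ge0.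
have aal t : `|a t| <= al by exact: norm_trig.
pose C := 4 * al / S ^+ 3 + (1 + 2 * al) ^+ 3 / S ^+ 4.
have C0 : 0 < C.
  by rewrite ltr_wpDl ?divr_ge0 ?mulr_ge0 ?exprn_ge0 ?(ltW S0)//
     divr_gt0// exprn_gt0//; lra.
have pi0 := @pi_gt0 R.
pose K := pi *+ 2 * s ^+ 2 * C.
have K0 : 0 < K by rewrite !mulr_gt0 ?exprn_gt0 ?pi2_gt0.
exists (Num.min 1 (eta / K)); first by rewrite lt_min ltr01 divr_gt0.
move=> r; rewrite lt_min => /and3P[r0 r1 rK].
have den t : 0 < S + (r ^+ 2 + 2 * r * a t).
  rewrite /S -addrA -enorm_sqr_circ; exact: barrier_denom_gt0.
pose q t := s ^+ 2 * ((S^-1 - r ^+ 2 / S ^+ 2 - C * r ^+ 3)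
   + (cos t * (- (2 * r / S ^+ 2) * x1) + sin t * (- (2 * r / S ^+ 2) * x2))
   + (4 * r ^+ 2 / S ^+ 3 * x1 ^+ 2 * cos t ^+ 2
      + 4 * r ^+ 2 / S ^+ 3 * x2 ^+ 2 * sin t ^+ 2
      + 8 * r ^+ 2 / S ^+ 3 * x1 * x2 * (sin t * cos t))).
have q_le t : q t <= barrier s zs (circ z0 r t).
  rewrite /barrier enorm_sqr_circ addrA -/A -/S -/x1 -/x2 -/(a t).
  rewrite ler_pM2l ?exprn_gt0//.
  apply: le_trans (inv_lower_bound S0 (den t)).
  have -> : (S^-1 - r ^+ 2 / S ^+ 2 - C * r ^+ 3)
   + (cos t * (- (2 * r / S ^+ 2) * x1) + sin t * (- (2 * r / S ^+ 2) * x2))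
   + (4 * r ^+ 2 / S ^+ 3 * x1 ^+ 2 * cos t ^+ 2
      + 4 * r ^+ 2 / S ^+ 3 * x2 ^+ 2 * sin t ^+ 2
      + 8 * r ^+ 2 / S ^+ 3 * x1 * x2 * (sin t * cos t))
    = S^-1 - (r ^+ 2 + 2 * r * a t) / S ^+ 2
      + (4 * r ^+ 2 * a t ^+ 2 - 4 * al * r ^+ 3) / S ^+ 3
      - (1 + 2 * al) ^+ 3 * r ^+ 3 / S ^+ 4.
    by rewrite /C /a; field; rewrite gt_eqF.
  have /andP[a1 a2] : - al <= a t <= al by rewrite -ler_norml.
  have r3 : 0 < r ^+ 3 by rewrite exprn_gt0.
  have r2 : r ^+ 2 <= r by rewrite expr2 ler_piMl// ltW.
  apply: lerB; last first.
    rewrite ler_pM2r ?invr_gt0 ?exprn_gt0//.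
    rewrite (le_trans (ler_norm _))// normrX -exprMn.
    apply: lerXn2r; rewrite ?nnegrE ?normr_ge0//.
      by rewrite mulr_ge0 ?(ltW r0)//; lra.
    have u1 : r * a t <= r * al by rewrite ler_pM2l.
    have u2 : r * - al <= r * a t by rewrite ler_pM2l.
    have u3 := sqr_ge0 r.
    by rewrite ler_norml; apply/andP; split; lra.
  apply: lerD => //; rewrite ler_pM2r ?invr_gt0 ?exprn_gt0//.
  have -> : (r ^+ 2 + 2 * r * a t) ^+ 2
    = 4 * r ^+ 2 * a t ^+ 2 + 4 * r ^+ 3 * a t + r ^+ 4 by ring.
  have : 0 <= r ^+ 4 by rewrite exprn_ge0// ltW.
  have : 0 <= r ^+ 3 * (al + a t) by rewrite mulr_ge0//; lra.
  by move: (r ^+ 4) => ?; lra.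
have c1 : continuous (fun t => cos t * (- (2 * r / S ^+ 2) * x1)
                             + sin t * (- (2 * r / S ^+ 2) * x2)).
  by apply: continuous_add; apply: continuous_mul;
    [exact: continuous_cos|exact: continuous_const
    |exact: continuous_sin|exact: continuous_const].
have c0 := @continuous_const R (S^-1 - r ^+ 2 / S ^+ 2 - C * r ^+ 3).
have c2 := @continuous_quad R (4 * r ^+ 2 / S ^+ 3 * x1 ^+ 2)
   (4 * r ^+ 2 / S ^+ 3 * x2 ^+ 2) (8 * r ^+ 2 / S ^+ 3 * x1 * x2).
have c01 := continuous_add c0 c1; have c012 := continuous_add c01 c2.
have qc : continuous q by apply: continuous_mul => //; exact: continuous_const.
have intq : cint q = s ^+ 2 * ((S^-1 - r ^+ 2 / S ^+ 2 - C * r ^+ 3) * (pi *+ 2)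
  + pi * (4 * r ^+ 2 / S ^+ 3 * A)).
  rewrite cintZ// cintD// cintD// cint_trig1 cint_quad cint_cst addr0.
  by rewrite -mulrDr -enorm_sqr_plane.
have wc : continuous (fun t => barrier s zs (circ z0 r t)).
  by move=> t; apply: continuous_along; exact: barrier_continuous.
have := cint_le qc wc q_le; rewrite intq; set I := cint _ => HI.
have -> : barrier s zs z0 = s ^+ 2 / S by [].
have Kr : K * r ^+ 3 <= eta * r ^+ 2.
  rewrite exprSr mulrCA [leRHS]mulrC ler_pM2l ?exprn_gt0//.
  by rewrite mulrC -ler_pdivlMr// ltW.
have AE : A = S - s ^+ 2 by rewrite /S addrAC subrr add0r.
have alg (C' S' p : R) : S' != 0 ->
    2 * p * s ^+ 2 * (S' - s ^+ 2 - s ^+ 2) / S' ^+ 3 * r ^+ 2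
    - p *+ 2 * s ^+ 2 * C' * r ^+ 3
  = s ^+ 2 * ((S'^-1 - r ^+ 2 / S' ^+ 2 - C' * r ^+ 3) * (p *+ 2)
  + p * (4 * r ^+ 2 / S' ^+ 3 * (S' - s ^+ 2))) - s ^+ 2 / S' * (p *+ 2).
  by move=> S'0; field.
have := alg C S pi; rewrite gt_eqF// -AE => /(_ isT) E.
move: E HI Kr; rewrite -/K.
by lra.
Qed.

End Barrier.

(** * Interior estimates for holomorphic discs *)

Section SegmentLipschitz.
Context {R : realType}.
Local Notation plane := 'cV[R]_(1 + 1).

Lemma disc_segment (zs z z' : plane) rho s : 0 <= s <= 1 ->
  disc zs rho z -> disc zs rho z' -> disc zs rho (z + s *: (z' - z)).
Proof.
rewrite /disc/= => /andP[s0 s1] dz dz'.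
have -> : z + s *: (z' - z) - zs = (1 - s) *: (z - zs) + s *: (z' - zs).
  by apply/matrixP => i j; rewrite !mxE; ring.
rewrite (le_lt_trans (enormD _ _))// !enormZ !ger0_norm ?subr_ge0//.
have [->|sn0] := eqVneq s 0; first by rewrite subr0 mul1r mul0r addr0.
have : s * enorm (z' - zs) < s * rho by rewrite ltr_pM2l// lt_def sn0.
have : (1 - s) * enorm (z - zs) <= (1 - s) * rho.
  by rewrite ler_wpM2l ?subr_ge0// ltW.
lra.
Qed.

Lemma disc_lipschitz (f : plane -> R) zs rho K z z' :
  (forall y, disc zs rho y -> differentiable f y) ->
  (forall y w, disc zs rho y -> `|'d f y w| <= K * enorm w) ->
  disc zs rho z -> disc zs rho z' -> `|f z' - f z| <= K * enorm (z' - z).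
Proof.
move=> fd fK dz dz'.
pose g (s : R) := z + s *: (z' - z).
have dg (s : R) : is_derive s 1 g (z' - z).
  have H := is_derive_scale (z' - z) (is_derive_id s (1 : R)).
  by apply: (is_derive_eq (is_deriveD (is_derive_cst z s 1) H)); rewrite add0r scale1r.
have gd s : 0 <= s <= 1 -> disc zs rho (g s) by move=> s01; exact: disc_segment.
have dfg (s : R) : 0 <= s <= 1 -> is_derive s 1 (f \o g) ('d f (g s) (z' - z)).
  by move=> s01; apply: is_derive_curve (dg s); apply: fd; exact: gd.
have fgc : {within `[0, 1], continuous (f \o g)}.
  by apply: derivable_within_continuous => s; rewrite in_itv/= => /dfg; case.
have dfg' (s : R) : s \in `]0, 1[ -> is_derive s 1 (f \o g) ('d f (g s) (z' - z)).
  by rewrite in_itv/= => /andP[s0 s1]; apply: dfg; rewrite !ltW.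
have [c] := MVT ltr01 dfg' fgc; rewrite in_itv/= => /andP[c0 c1].
have g0 : g 0 = z by rewrite /g scale0r addr0.
have g1 : g 1 = z' by rewrite /g scale1r addrC subrK.
rewrite /= g0 g1 subr0 mulr1 => ->.
by apply: fK; apply: gd; rewrite !ltW.
Qed.

End SegmentLipschitz.

Section Arithmetic.
Context {R : realFieldType}.

Lemma le1_of_small (e : R) : e * 10000 <= 1 -> e <= 1.
Proof. by lra. Qed.

Lemma small_product (e k : R) : e * 10000 <= 1 -> k <= e * 6 ->
  108 * k <= 648 / 10000.
Proof. by lra. Qed.

Lemma mean_comparison (x q Sz Ss A B : R) :
  `|Ss - A| <= q -> `|Sz - B| <= q -> `|Sz - Ss| <= 192 / 1000 * x ->
  q <= 648 / 10000 * x -> 0 <= x -> A - B <= x / 2.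
Proof. by do 3 ![rewrite ler_norml => /andP[? ?]]; lra. Qed.

Lemma half_le (M d s : R) : M <= d + s -> d <= M / 2 -> M / 2 <= s.
Proof. by lra. Qed.

End Arithmetic.

Section HolomorphicDisc.
Context {R : realType} {n : nat}.
Local Notation plane := 'cV[R]_(1 + 1).
Variables (D : set 'cV[R]_(n + n)) (J : 'cV[R]_(n + n) -> 'M[R]_(n + n)).
Variables (eps : R) (h : plane -> 'cV[R]_(n + n)).
Hypothesis eps0 : 0 <= eps.
Hypothesis Jac : almost_complex D J.
Hypothesis Jdiff : forall x, D x -> differentiable J x.
Hypothesis Jle2 : forall x v, D x -> enorm (J x *m v) <= 2 * enorm v.
Hypothesis dJle : forall x X v, D x ->
  enorm ('D_X J x *m v) <= eps * enorm X * enorm v.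
Hypothesis hol : Jholomorphic D J h.
Hypothesis D1 : forall x, D x -> enorm x <= 1.

Let hD z : Delta z -> D (h z). Proof. by case: hol => + _ _; exact. Qed.
Let h1 : C1_on Delta h. Proof. by case: hol. Qed.
Let hJ z w : Delta z -> J (h z) *m 'd h z w = 'd h z (Jst R 1 *m w).
Proof. by case: hol => _ _ H Dz; exact: H. Qed.

(** The derivative along the imaginary axis is J times the derivative along the
    real axis, so this controls the whole differential. *)
Definition speed z := enorm ('D_e1 h z).

Lemma derive_e2 z : Delta z -> 'D_e2 h z = J (h z) *m 'D_e1 h z.
Proof.
move=> Dz; have hz := h1.1 z Dz.
by rewrite [X in _ *m X]deriveE// hJ// Jst_e1 deriveE.
Qed.

Lemma diff_norm_le z w : Delta z -> enorm ('d h z w) <= 3 * speed z * enorm w.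
Proof.
move=> Dz; rewrite diff_plane; last exact: h1.1.
rewrite [X in _ + _ *: X](derive_e2 Dz).
apply: (le_trans (enormD _ _)); rewrite 2!enormZ.
have [w1 w2] := plane_coord_le w.
have s0 : 0 <= speed z by exact: enorm_ge0.
have Js : enorm (J (h z) *m 'D_e1 h z) <= 2 * speed z by apply: Jle2; exact: hD.
have : `|w 0 0| * speed z <= enorm w * speed z by rewrite ler_wpM2r.
have : `|w ord_max 0| * enorm (J (h z) *m 'D_e1 h z) <= enorm w * (2 * speed z).
  by apply: ler_pM => //; exact: enorm_ge0.
by rewrite -/(speed z); lra.
Qed.

Lemma diff_cis_cisd z t : Delta z ->
  'd h z (cis t) = - (J (h z) *m 'd h z (cisd t)).
Proof.
move=> Dz; rewrite -Jst_cis -hJ// mulmxA Jac; last exact: hD.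
by rewrite mulNmx mul1mx opprK.
Qed.

Lemma dotp_h_differentiable w z : Delta z ->
  differentiable (fun z => dotp w (h z)) z.
Proof. by move=> Dz; apply: differentiable_dotp; exact: h1.1. Qed.

Lemma dotp_h_diff w z v : Delta z ->
  'd (fun z => dotp w (h z)) z v = dotp w ('d h z v).
Proof.
move=> Dz; rewrite -deriveE; last exact: dotp_h_differentiable.
rewrite derive_dotp; first by rewrite deriveE//; exact: h1.1.
by apply: diff_derivable; exact: h1.1.
Qed.

Lemma dotp_h_C1 w : C1_on Delta (fun z => dotp w (h z)).
Proof.
split; first exact: dotp_h_differentiable.
move=> v z Dz; apply: (continuous_open_eq Delta_open Dz
   (f := fun z => dotp w ('D_v h z))).
  move=> y Dy; rewrite derive_dotp//.
  by apply: diff_derivable; exact: h1.1.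
by apply: continuous_dotp; exact: h1.2.
Qed.

Section OnDisc.
Variables (zs : plane) (rho P : R).
Hypothesis dD : disc zs rho `<=` @Delta R.
Hypothesis sP : forall z, disc zs rho z -> speed z <= P.

Let dhP z w : disc zs rho z -> enorm ('d h z w) <= 3 * P * enorm w.
Proof.
move=> dz; rewrite (le_trans (diff_norm_le _ (dD dz)))//.
by rewrite ler_wpM2r ?enorm_ge0// ler_pM2l// sP.
Qed.

Lemma P_ge0 z : disc zs rho z -> 0 <= P.
Proof. by move=> /sP; apply: le_trans; exact: enorm_ge0. Qed.

Lemma h_lipschitz z z' : disc zs rho z -> disc zs rho z' ->
  enorm (h z' - h z) <= 3 * P * enorm (z' - z).
Proof.
move=> dz dz'; apply: enorm_le_dual.
  by rewrite !mulr_ge0 ?enorm_ge0 ?(P_ge0 dz).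
move=> w; rewrite dotpBr (le_trans (ler_norm _))//.
rewrite mulrA; apply: (@disc_lipschitz _ (fun z => dotp w (h z)) zs rho) => //.
  by move=> y /dD; exact: dotp_h_differentiable.
move=> y v dy; rewrite dotp_h_diff; last exact: dD.
by rewrite (le_trans (normr_dotp _ _))// -mulrA ler_wpM2l ?enorm_ge0// dhP.
Qed.

(** J is compared along the disc, not along a segment between h z and h z',
    since D need not be convex. *)
Lemma J_lipschitz z z' v : disc zs rho z -> disc zs rho z' ->
  enorm ((J (h z') - J (h z)) *m v) <= eps * (3 * P) * enorm (z' - z) * enorm v.
Proof.
move=> dz dz'; apply: enorm_le_dual.
  by rewrite !mulr_ge0 ?enorm_ge0 ?(P_ge0 dz).
move=> w; rewrite mulmxBl dotpBr (le_trans (ler_norm _))//.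
pose l (M : 'M[R]_(n + n)) : R := dotp w (M *m v).
have ll : linear l by move=> a A B; rewrite /l mulmxDl -scalemxAl dotpDr dotpZr.
have lc : continuous l.
  move=> M; apply: continuous_sumr => i; apply: continuousM.
    exact: cst_continuous.
  rewrite (_ : (fun M : 'M[R]_(n + n) => (M *m v) i 0) = (fun M => \sum_j M i j * v j 0)).
    apply: continuous_sumr => j; apply: continuousM; last exact: cst_continuous.
    exact: coord_continuous.
  by apply/funext => M'; rewrite mxE.
have Jhd y : disc zs rho y -> differentiable (J \o h) y.
  by move=> /dD dy; apply: differentiable_comp; [exact: h1.1|apply: Jdiff; exact: hD].
have -> : enorm w * (eps * (3 * P) * enorm (z' - z) * enorm v)
   = enorm w * (eps * (3 * P) * enorm v) * enorm (z' - z) by ring.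
apply: (@disc_lipschitz _ (l \o (J \o h)) zs rho) => //.
  by move=> y dy; apply: differentiable_linear => //; exact: Jhd.
move=> y x dy; have lJh : differentiable (l \o (J \o h)) y.
  by apply: differentiable_linear => //; exact: Jhd.
have -> : 'd (l \o (J \o h)) y x = l ('D_('d h y x) J (h y)).
  rewrite -deriveE//.
  have [_ ->] := is_derive_linear ll lc (derivableP (@diff_derivable _ _ _ (J \o h) y x (Jhd y dy))).
  have hy : differentiable h y by apply: h1.1; exact: dD.
  have Jy : differentiable J (h y) by apply/Jdiff/hD/dD.
  have E := @deriveE _ _ _ (J \o h) y x (Jhd y dy).
  rewrite (diff_comp hy Jy) in E.
  by rewrite [in LHS]/= E /= (@deriveE _ _ _ J (h y) _ Jy).
rewrite (le_trans (normr_dotp _ _))// -[leRHS]mulrA ler_wpM2l ?enorm_ge0//.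
apply: le_trans (dJle _ _ (hD (dD dy))) _.
rewrite [leRHS]mulrAC ler_wpM2r ?enorm_ge0// -mulrA ler_wpM2l//.
exact: dhP.
Qed.

(** The integral over the circle of exp(- t J0) h(z + r e^(it)), tested against w,
    where J0 = J (h z).  If h were complex linear for the constant structure
    J0, this would be 2 pi r 'D_e1 h z; divided by 2 pi r it is, for small r, an
    approximation of the derivative that involves only the values of h. *)
Definition rot_mean w z r := cint (fun t =>
  cos t * dotp w (h (circ z r t))
  - sin t * dotp ((J (h z))^T *m w) (h (circ z r t))).

(** The derivative of rot_mean with respect to r. *)
Definition rot_mean' w z r := cint (fun t =>
  cos t * dotp w ('d h (circ z r t) (cis t))
  - sin t * dotp ((J (h z))^T *m w) ('d h (circ z r t) (cis t))).

Let dotpC1 w : C1_on (disc zs rho) (fun z => dotp w (h z)).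
Proof. by apply: C1_on_sub dD _; exact: dotp_h_C1. Qed.

Let cc := @continuous_cos R.
Let cs := @continuous_sin R.

Lemma continuous_dotp_circ w r : `|r| < rho ->
  continuous (fun t => dotp w (h (circ zs r t))).
Proof. exact: (continuous_circ (dotpC1 w)). Qed.

Lemma continuous_dotp_diff_cis w r : `|r| < rho ->
  continuous (fun t => dotp w ('d h (circ zs r t) (cis t))).
Proof.
move=> r1; rewrite (_ : (fun t => _) =
    (fun t => 'd (fun z => dotp w (h z)) (circ zs r t) (cis t))).
  exact: (continuous_diff_cis (dotpC1 w)).
by apply/funext => t; rewrite dotp_h_diff//; apply: dD; exact: circ_in.
Qed.

Lemma continuous_dotp_diff_cisd w r : `|r| < rho ->
  continuous (fun t => dotp w ('d h (circ zs r t) (cisd t))).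
Proof.
move=> r1; rewrite (_ : (fun t => _) =
    (fun t => 'd (fun z => dotp w (h z)) (circ zs r t) (cisd t))).
  exact: (continuous_diff_cisd (dotpC1 w)).
by apply/funext => t; rewrite dotp_h_diff//; apply: dD; exact: circ_in.
Qed.

Lemma rot_mean_is_derive w (r : R) : `|r| < rho ->
  is_derive r 1 (rot_mean w zs) (rot_mean' w zs r).
Proof.
move=> r1; set w' := (J (h zs))^T *m w.
have itvE s : (s \in `]- rho, rho[) = (`|s| < rho) by rewrite in_itv/= ltr_norml.
apply: (@cint_is_derive _
  (fun s t => cos t * dotp w (h (circ zs s t)) - sin t * dotp w' (h (circ zs s t)))
  (fun s t => cos t * dotp w ('d h (circ zs s t) (cis t))
              - sin t * dotp w' ('d h (circ zs s t) (cis t)))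
  (- rho) rho r (enorm w * (3 * P) + enorm w' * (3 * P))).
- by rewrite itvE.
- move=> s; rewrite itvE => s1.
  by apply: continuous_sub; apply: continuous_mul => //; exact: continuous_dotp_circ.
- move=> s t; rewrite itvE => s1; have Ds := circ_in zs t s1.
  have dw v : is_derive s 1 (fun s => dotp v (h (circ zs s t)))
      (dotp v ('d h (circ zs s t) (cis t))).
    rewrite -dotp_h_diff; last exact: dD.
    apply: (is_derive_along_radius (F := fun z => dotp v (h z))).
    by apply: dotp_h_differentiable; exact: dD.
  exact: (is_deriveB (is_deriveZ (cos t) (dw w)) (is_deriveZ (sin t) (dw w'))).
- move=> s t; rewrite itvE => s1; have Ds := circ_in zs t s1.
  have bd v : `|dotp v ('d h (circ zs s t) (cis t))| <= enorm v * (3 * P).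
    rewrite (le_trans (normr_dotp _ _))// ler_wpM2l ?enorm_ge0//.
    by rewrite (le_trans (dhP _ Ds))// enorm_cis mulr1.
  rewrite (le_trans (ler_normB _ _))// !normrM; apply: lerD.
    by rewrite -[leRHS]mul1r ler_pM ?normr_ge0// cos_max.
  by rewrite -[leRHS]mul1r ler_pM ?normr_ge0// sin_max.
Qed.

Lemma zs_disc : 0 < rho -> disc zs rho zs.
Proof. by rewrite /disc/= subrr enorm0. Qed.

(** For a constant structure J0 the radial derivative of h is - J0 / r times the
    angular one, and an integration by parts shows that rot_mean is linear in
    r.  In general J - J0 is at most 3 eps P r on the circle and the angular
    derivative of h is at most 3 P r. *)
Lemma rot_mean_ode w r : 0 < r < rho ->
  `|r * rot_mean' w zs r - rot_mean w zs r|
    <= 27 * eps * P ^+ 2 * enorm w * (pi *+ 2) * r ^+ 2.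
Proof.
move=> /andP[r0 rrho]; have ar : `|r| < rho by rewrite gtr0_norm.
have rho0 := lt_trans r0 rrho; have Dzs := zs_disc rho0.
have Dc t : disc zs rho (circ zs r t) by exact: circ_in.
set J0 := J (h zs); set w' := J0^T *m w.
have J0J0 : J0 *m J0 = - 1%:M by apply/Jac/hD/dD.
have w'J v : dotp w' v = dotp w (J0 *m v) by rewrite dotp_mulmx.
pose er t := (J (h (circ zs r t)) - J0) *m 'd h (circ zs r t) (cisd t).
have dcis t : 'd h (circ zs r t) (cis t)
    = - (J0 *m 'd h (circ zs r t) (cisd t)) - er t.
  rewrite diff_cis_cisd; last exact: dD.
  by rewrite /er mulmxBl opprB addrA addNr add0r.
have er_le t : enorm (er t) <= 9 * eps * P ^+ 2 * r.
  have := J_lipschitz ('d h (circ zs r t) (cisd t)) Dzs (Dc t).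
  rewrite circ_disc gtr0_norm// => /le_trans; apply.
  have := dhP (cisd t) (Dc t); rewrite enorm_cisd mulr1 => dh.
  have -> : 9 * eps * P ^+ 2 * r = eps * (3 * P) * r * (3 * P) by ring.
  by rewrite ler_wpM2l// !mulr_ge0 ?(P_ge0 Dzs)// ltW.
have pc v : continuous (fun t => dotp v (h (circ zs r t))).
  exact: continuous_dotp_circ.
have pd v : continuous (fun t => dotp v ('d h (circ zs r t) (cisd t))).
  exact: continuous_dotp_diff_cisd.
have dt v (t : R) : is_derive t 1 (fun t => dotp v (h (circ zs r t)))
    (r * dotp v ('d h (circ zs r t) (cisd t))).
  rewrite -dotp_h_diff; last by apply: dD; exact: Dc.
  apply: (is_derive_along_angle (F := fun z => dotp v (h z))).
  by apply: dotp_h_differentiable; apply: dD; exact: Dc.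
have rpd v : continuous (fun t => r * dotp v ('d h (circ zs r t) (cisd t))).
  by apply: continuous_mul => //; exact: continuous_const.
have nsc := continuous_opp cs.
have parts_cos : cint (fun t => cos t * (r * dotp w' ('d h (circ zs r t) (cisd t))))
    = - cint (fun t => - sin t * dotp w' (h (circ zs r t))).
  apply: cint_parts => //.
  by rewrite cos2pi cos0 circ_2pi.
have parts_sin : cint (fun t => sin t * (r * dotp w ('d h (circ zs r t) (cisd t))))
    = - cint (fun t => cos t * dotp w (h (circ zs r t))).
  by apply: cint_parts => //; rewrite sin2pi sin0 !mul0r.
pose E t := r * (- (cos t * dotp w (er t)) + sin t * dotp w (J0 *m er t)).
have E_def t : r * (cos t * dotp w ('d h (circ zs r t) (cis t))
        - sin t * dotp w' ('d h (circ zs r t) (cis t)))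
   = E t - (cos t * (r * dotp w' ('d h (circ zs r t) (cisd t)))
   + sin t * (r * dotp w ('d h (circ zs r t) (cisd t)))).
  rewrite dcis !w'J /E mulmxBr mulmxN mulmxA J0J0 mulNmx mul1mx opprK.
  by rewrite !(dotpBr, dotpNr); ring.
have c1 : continuous (fun t => r * (cos t * dotp w ('d h (circ zs r t) (cis t))
        - sin t * dotp w' ('d h (circ zs r t) (cis t)))).
  apply: continuous_mul; first exact: continuous_const.
  by apply: continuous_sub; apply: continuous_mul => //; exact: continuous_dotp_diff_cis.
have c2 : continuous (fun t => cos t * (r * dotp w' ('d h (circ zs r t) (cisd t)))).
  exact: continuous_mul.
have c3 : continuous (fun t => sin t * (r * dotp w ('d h (circ zs r t) (cisd t)))).
  exact: continuous_mul.
have Ec : continuous E.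
  rewrite (_ : E = (fun t => r * (cos t * dotp w ('d h (circ zs r t) (cis t))
        - sin t * dotp w' ('d h (circ zs r t) (cis t)))
   + (cos t * (r * dotp w' ('d h (circ zs r t) (cisd t)))
   + sin t * (r * dotp w ('d h (circ zs r t) (cisd t)))))).
    by apply: continuous_add => //; exact: continuous_add.
  by apply/funext => t; rewrite E_def subrK.
have c4 : continuous (fun t => cos t * dotp w (h (circ zs r t))) by exact: continuous_mul.
have c5 : continuous (fun t => sin t * dotp w' (h (circ zs r t))) by exact: continuous_mul.
have -> : r * rot_mean' w zs r - rot_mean w zs r = cint E.
  rewrite /rot_mean' /rot_mean -/J0 -/w' -cintZ; last first.
    by apply: continuous_sub; apply: continuous_mul => //; exact: continuous_dotp_diff_cis.
  rewrite (_ : (fun t => r * _) = (fun t => E t -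
     (cos t * (r * dotp w' ('d h (circ zs r t) (cisd t)))
   + sin t * (r * dotp w ('d h (circ zs r t) (cisd t)))))); last first.
    by apply/funext => t; exact: E_def.
  rewrite cintB//; last exact: continuous_add.
  rewrite cintD// parts_cos parts_sin cintB//.
  rewrite (_ : (fun t => - sin t * _) = (fun t => (-1) * (sin t * dotp w' (h (circ zs r t))))).
    by rewrite (cintZ (-1) c5); ring.
  by apply/funext => t; rewrite mulN1r mulNr.
rewrite (_ : 27 * _ * _ * _ * _ * _
  = 27 * eps * P ^+ 2 * enorm w * r ^+ 2 * (pi *+ 2)); last ring.
apply: cint_norm_le => // t.
have d1 : `|dotp w (er t)| <= enorm w * (9 * eps * P ^+ 2 * r).
  by rewrite (le_trans (normr_dotp _ _))// ler_wpM2l ?enorm_ge0.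
have d2 : `|dotp w (J0 *m er t)| <= enorm w * (2 * (9 * eps * P ^+ 2 * r)).
  rewrite (le_trans (normr_dotp _ _))// ler_wpM2l ?enorm_ge0//.
  apply: (le_trans (Jle2 _ (hD (dD Dzs)))).
  by rewrite ler_pM2l.
rewrite /E normrM gtr0_norm//.
have -> : 27 * eps * P ^+ 2 * enorm w * r ^+ 2 =
  r * (enorm w * (9 * eps * P ^+ 2 * r) + enorm w * (2 * (9 * eps * P ^+ 2 * r))) by ring.
rewrite ler_pM2l// (le_trans (ler_normD _ _))// normrN !normrM; apply: lerD.
  by rewrite -[leRHS]mul1r ler_pM ?normr_ge0// cos_max.
by rewrite -[leRHS]mul1r ler_pM ?normr_ge0// sin_max.
Qed.

Lemma rot_mean0 w : rot_mean w zs 0 = 0.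
Proof.
rewrite -[RHS](cint_trig1 (dotp w (h zs)) (- dotp ((J (h zs))^T *m w) (h zs))).
by congr cint; apply/funext => t; rewrite circ0 mulrN.
Qed.

Lemma rot_mean'0 w : 0 < rho ->
  rot_mean' w zs 0 = dotp w ('D_e1 h zs) * (pi *+ 2).
Proof.
move=> rho0; have Dz := dD (zs_disc rho0).
rewrite -cint_cst; congr cint; apply/funext => t; rewrite circ0.
have J0J0 : J (h zs) *m J (h zs) = - 1%:M by apply/Jac/hD.
rewrite diff_cis; last exact: h1.1.
rewrite [X in _ *: _ + _ *: X](derive_e2 Dz).
rewrite -(dotp_mulmx (J (h zs)) w) mulmxDr -!scalemxAr mulmxA J0J0 mulNmx mul1mx.
rewrite !(dotpDr, dotpZr, dotpNr) -[RHS]mul1r -(cos2Dsin2 t); ring.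
Qed.

(** By rot_mean_ode the derivative of rot_mean / r is bounded, and rot_mean / r
    tends to 2 pi 'D_e1 h zs as r tends to 0. *)
Lemma rot_mean_estimate w r : 0 < r < rho ->
  `|rot_mean w zs r / r - dotp w ('D_e1 h zs) * (pi *+ 2)|
    <= 27 * eps * P ^+ 2 * enorm w * (pi *+ 2) * r.
Proof.
move=> /andP[r0 rrho]; have rho0 := lt_trans r0 rrho.
set Q := 27 * _ * _ * _ * _.
have Q0 : 0 <= Q.
  have p2 := ltW (@pi2_gt0 R); have := sqr_ge0 P.
  by rewrite /Q; move: (P ^+ 2) => P2 P20; rewrite !mulr_ge0 ?enorm_ge0.
set L := dotp _ _ * _.
pose q s := rot_mean w zs s * s^-1.
have dq (s : R) : 0 < s < rho ->
    is_derive s 1 q ((s * rot_mean' w zs s - rot_mean w zs s) / s ^+ 2).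
  move=> /andP[s0 srho]; have sn0 : s != 0 by rewrite gt_eqF.
  have as_ : `|s| < rho by rewrite gtr0_norm.
  have dV := is_deriveV sn0 (is_derive_id s (1 : R)).
  apply: (is_derive_eq (is_derive_mul (rot_mean_is_derive w as_) dV)).
  by rewrite -[_ *: _]/(_ * _); field.
have q_lip a b : 0 < a < b -> b < rho -> `|q b - q a| <= Q * (b - a).
  move=> /andP[a0 ab] brho.
  have dq' (s : R) : s \in `]a, b[ ->
      is_derive s 1 q ((s * rot_mean' w zs s - rot_mean w zs s) / s ^+ 2).
    rewrite in_itv/= => /andP[sa sb]; apply: dq.
    by rewrite (lt_trans a0 sa) (lt_trans sb brho).
  have qc : {within `[a, b], continuous q}.
    apply: derivable_within_continuous => s; rewrite in_itv/= => /andP[sa sb].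
    by case: (@dq s) => //; rewrite (lt_le_trans a0 sa) (le_lt_trans sb brho).
  have [c] := MVT ab dq' qc; rewrite in_itv/= => /andP[ac cb] ->.
  have c0 : 0 < c by exact: lt_trans ac.
  have cr : 0 < c < rho by rewrite c0 (lt_trans cb).
  rewrite normrM [X in _ * X]gtr0_norm ?subr_gt0// ler_pM2r ?subr_gt0//.
  rewrite normrM normfV [X in _ / X]ger0_norm ?sqr_ge0//.
  by rewrite ler_pdivrMr ?exprn_gt0// rot_mean_ode.
rewrite -/(q r); apply/ler_addgt0Pr => eta eta0.
have [] := @rot_mean_is_derive w 0; first by rewrite normr0.
rewrite rot_mean'0// -/L => S0 S0L.
have : h^-1 *: ((rot_mean w zs \o shift 0) (h *: 1) - rot_mean w zs 0) @[h --> 0^'] --> L.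
  by rewrite -S0L; exact: S0.
move=> /cvgrPdist_le/(_ _ eta0)/nbhs_ballP[d /= d0 Hd].
pose r' := Num.min d r / 2.
have m0 : 0 < Num.min d r by rewrite lt_min d0.
have r'0 : 0 < r' by rewrite divr_gt0.
have : r' < Num.min d r by rewrite /r' ltr_pdivrMr// ltr_pMr// ltr1n.
rewrite lt_min => /andP[r'd r'r].
have /Hd : ball 0 d r' by rewrite /ball/= sub0r normrN gtr0_norm.
rewrite gt_eqF// => /(_ isT).
rewrite /= addr0 rot_mean0 subr0 -[_ *: 1]/(_ * 1) mulr1.
rewrite -[_ *: _]/(_ * _) mulrC -/(q r') distrC => H2.
have H1 : `|q r - q r'| <= Q * (r - r') by apply: q_lip => //; rewrite r'0.
have -> : q r - L = (q r - q r') + (q r' - L) by rewrite addrA subrK.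
rewrite (le_trans (ler_normD _ _))// lerD// (le_trans H1)// ler_wpM2l//.
by rewrite gerBl ltW.
Qed.

Lemma continuous_dotp_circle w z r : (forall t, Delta (circ z r t)) ->
  continuous (fun t => dotp w (h (circ z r t))).
Proof.
move=> zr t; apply: (continuous_along (F := fun z => dotp w (h z))).
by apply: differentiable_continuous; exact: dotp_h_differentiable.
Qed.

Lemma speed_le r : 0 < r < rho -> speed zs <= 3 / r + 27 * eps * P ^+ 2 * r.
Proof.
move=> /andP[r0 rrho]; have rho0 := lt_trans r0 rrho.
have ar : `|r| < rho by rewrite gtr0_norm.
have Dc t : Delta (circ zs r t) by apply: dD; exact: circ_in.
have Dz := dD (zs_disc rho0).
apply: enorm_le_dual.
  have := sqr_ge0 P; move: (P ^+ 2) => P2 P20.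
  by rewrite addr_ge0 ?divr_ge0 ?mulr_ge0// ltW.
move=> w; have p2 := @pi2_gt0 R.
have S1 : `|rot_mean w zs r| <= (3 * enorm w) * (pi *+ 2).
  apply: cint_norm_le.
    by apply: continuous_sub; apply: continuous_mul;
      [exact: continuous_cos|exact: continuous_dotp_circle
      |exact: continuous_sin|exact: continuous_dotp_circle].
  move=> t; rewrite -dotp_mulmx; have h1' := D1 (hD (Dc t)).
  have d1 : `|dotp w (h (circ zs r t))| <= enorm w.
    by rewrite (le_trans (normr_dotp _ _))// ler_piMr ?enorm_ge0.
  have d2 : `|dotp w (J (h zs) *m h (circ zs r t))| <= 2 * enorm w.
    rewrite (le_trans (normr_dotp _ _))// mulrC ler_wpM2r ?enorm_ge0//.
    by apply: (le_trans (Jle2 _ (hD Dz))); rewrite ler_piMr.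
  rewrite (le_trans (ler_normB _ _))// !normrM.
  rewrite (_ : 3 * enorm w = 1 * enorm w + 1 * (2 * enorm w)); last ring.
  by apply: lerD; apply: ler_pM; rewrite ?normr_ge0 ?cos_max ?sin_max.
have := @rot_mean_estimate w r; rewrite r0 rrho => /(_ isT).
rewrite ler_norml => /andP[+ _].
have S2 : rot_mean w zs r / r <= 3 * enorm w * (pi *+ 2) / r.
  by rewrite ler_pM2r ?invr_gt0// (le_trans (ler_norm _)).
move=> S3; rewrite -(ler_pM2r p2).
have -> : enorm w * (3 / r + 27 * eps * P ^+ 2 * r) * (pi *+ 2)
  = 3 * enorm w * (pi *+ 2) / r + 27 * eps * P ^+ 2 * enorm w * (pi *+ 2) * r by ring.
by lra.
Qed.

Lemma rot_mean_diff w z r : eps <= 1 -> disc zs rho z ->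
  (forall t, disc zs rho (circ z r t)) -> (forall t, disc zs rho (circ zs r t)) ->
  `|rot_mean w z r - rot_mean w zs r|
    <= enorm w * (12 * P * enorm (z - zs)) * (pi *+ 2).
Proof.
move=> eps1 dz dzt dst.
have dzs : disc zs rho zs.
  by apply: zs_disc; apply: le_lt_trans dz; exact: enorm_ge0.
have P0 := P_ge0 dzs.
have cont y v : (forall t, disc zs rho (circ y r t)) ->
    continuous (fun t => dotp v (h (circ y r t))).
  by move=> yD; apply: continuous_dotp_circle => t; exact: dD.
have c1 y v v' : (forall t, disc zs rho (circ y r t)) -> continuous (fun t =>
   cos t * dotp v (h (circ y r t)) - sin t * dotp v' (h (circ y r t))).
  by move=> yD; apply: continuous_sub; apply: continuous_mul => //; exact: cont.
rewrite -cintB; [|exact: c1|exact: c1].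
apply: cint_norm_le; first by apply: continuous_sub; exact: c1.
move=> t; rewrite -!dotp_mulmx.
set a := h (circ z r t); set b := h (circ zs r t).
set Jz := J (h z); set Js := J (h zs).
have ab : enorm (a - b) <= 3 * P * enorm (z - zs).
  apply: (le_trans (h_lipschitz (dst t) (dzt t))).
  by rewrite /circ opprD addrACA subrr addr0.
have Jab : enorm (Jz *m a - Js *m b) <= 9 * P * enorm (z - zs).
  have -> : Jz *m a - Js *m b = (Jz - Js) *m a + Js *m (a - b).
    by rewrite mulmxBl mulmxBr addrA subrK.
  rewrite (le_trans (enormD _ _))//.
  have t1 : enorm (Js *m (a - b)) <= 2 * (3 * P * enorm (z - zs)).
    by apply: (le_trans (Jle2 _ (hD (dD dzs)))); rewrite ler_pM2l.
  have t2 : enorm ((Jz - Js) *m a) <= 3 * P * enorm (z - zs).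
    apply: (le_trans (J_lipschitz a dzs dz)).
    have a1 : enorm a <= 1 by apply/D1/hD/dD/dzt.
    rewrite (_ : eps * (3 * P) * enorm (z - zs) * enorm a
      = (3 * P * enorm (z - zs)) * (eps * enorm a)); last ring.
    rewrite ler_piMr ?mulr_ge0 ?enorm_ge0//.
    by rewrite mulr_ile1 ?enorm_ge0.
  by lra.
have -> : cos t * dotp w a - sin t * dotp w (Jz *m a)
    - (cos t * dotp w b - sin t * dotp w (Js *m b))
   = cos t * dotp w (a - b) - sin t * dotp w (Jz *m a - Js *m b).
  by rewrite !dotpBr; ring.
have d1 : `|dotp w (a - b)| <= enorm w * (3 * P * enorm (z - zs)).
  by rewrite (le_trans (normr_dotp _ _))// ler_wpM2l ?enorm_ge0.
have d2 : `|dotp w (Jz *m a - Js *m b)| <= enorm w * (9 * P * enorm (z - zs)).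
  by rewrite (le_trans (normr_dotp _ _))// ler_wpM2l ?enorm_ge0.
rewrite (le_trans (ler_normB _ _))// !normrM.
rewrite (_ : enorm w * (12 * _ * _) = 1 * (enorm w * (3 * P * enorm (z - zs)))
  + 1 * (enorm w * (9 * P * enorm (z - zs)))); last ring.
by apply: lerD; apply: ler_pM; rewrite ?normr_ge0 ?cos_max ?sin_max.
Qed.

End OnDisc.
(** In this section zs maximizes the derivative of h up to a factor on the disc
    of radius rho. *)
Section Bubble.
Variables (zs : plane) (rho M : R).
Hypotheses (rho0 : 0 < rho) (M0 : 0 < M).
Hypothesis dD : disc zs rho `<=` @Delta R.
Hypothesis s4M : forall z, disc zs rho z -> speed z <= 4 * M.
Hypothesis sM : speed zs = M.
Hypothesis eps_small : eps * 10000 <= 1.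

(** Otherwise speed_le with r = 6 / M would give M <= M / 2 + 0.26 M. *)
Lemma bubble_scale : M * rho <= 6.
Proof.
rewrite leNgt; apply/negP => Mrho.
have Mn0 : M != 0 by rewrite gt_eqF.
have r0 : 0 < 6 / M by rewrite divr_gt0.
have rrho : 6 / M < rho by rewrite ltr_pdivrMr// mulrC.
have := @speed_le zs rho (4 * M) dD s4M (6 / M); rewrite r0 rrho => /(_ isT).
rewrite sM (_ : 3 / (6 / M) + _ = M / 2 + 2592 * (eps * M)); last by field.
have : 10000 * (eps * M) <= M.
  by rewrite mulrA (mulrC 10000) -[leRHS]mul1r ler_pM2r.
by move: (eps * M) => k; have := M0; lra.
Qed.

(** The circle of radius rho / 4 gives an approximation of the derivative of h
    with a relative error of order eps, because M rho is bounded, and this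
    approximation is Lipschitz in the centre of the circle.  Hence the
    derivative does not vary much near zs, although h has no second
    derivative. *)
Lemma bubble_speed z : enorm (z - zs) <= rho / 1000 -> M / 2 <= speed z.
Proof.
move=> zzs; have Mrho := bubble_scale.
have [rhop [Mp epsp]] := (rho0, (M0, eps_small)).
have eps1 : eps <= 1 by exact: le1_of_small.
set r := rho / 4.
have r0 : 0 < r by rewrite divr_gt0.
have sub y : disc z (rho / 2) y -> disc zs rho y.
  rewrite /disc/= => dy; rewrite -[y](subrK z) -addrA (le_lt_trans (enormD _ _))//.
  by lra.
have dzc t : disc zs rho (circ z r t).
  apply: sub; rewrite /disc/= circ_disc gtr0_norm// /r; lra.
have dsc t : disc zs rho (circ zs r t).
  by rewrite /disc/= circ_disc gtr0_norm// /r; lra.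
have dz : disc zs rho z by rewrite /disc/=; lra.
have rr : 0 < r < rho by rewrite r0 /r; lra.
have rr2 : 0 < r < rho / 2 by rewrite r0 /r; lra.
have diff : enorm ('D_e1 h zs - 'D_e1 h z) <= M / 2.
  apply: enorm_le_dual; first by rewrite divr_ge0// ltW.
  move=> w; rewrite dotpBr.
  have E1 := rot_mean_estimate dD s4M w rr.
  have E2 := @rot_mean_estimate z (rho / 2) (4 * M) (fun y yz => dD (sub y yz))
    (fun y yz => s4M (sub y yz)) w r rr2.
  have E3 := rot_mean_diff dD s4M w eps1 dz dzc dsc.
  have p2 := @pi2_gt0 R.
  set a := dotp w _; set b := dotp w _.
  have nw := enorm_ge0 w.
  (* 192 = 12 * 4 * 4, and 648 = 27 * 4 * 6 with M rho <= 6. *)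
  have E3' : `|rot_mean w z r / r - rot_mean w zs r / r|
      <= enorm w * (192 * M / 1000) * (pi *+ 2).
    rewrite -mulrBl normrM normfV (gtr0_norm r0) ler_pdivrMr//.
    apply: (le_trans E3).
    rewrite (_ : enorm w * (192 * M / 1000) * (pi *+ 2) * r
      = enorm w * (12 * (4 * M) * (rho / 1000)) * (pi *+ 2)); last by rewrite /r; field.
    rewrite ler_pM2r// ler_wpM2l// ler_wpM2l//.
    by rewrite !mulr_ge0// ltW.
  have Q : 27 * eps * (4 * M) ^+ 2 * enorm w * (pi *+ 2) * r
      <= enorm w * (648 * M / 10000) * (pi *+ 2).
    rewrite (_ : 27 * eps * (4 * M) ^+ 2 * enorm w * (pi *+ 2) * r
      = enorm w * (108 * (eps * (M * rho)) * M) * (pi *+ 2)); last by rewrite /r; field.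
    rewrite ler_pM2r// ler_wpM2l//.
    rewrite (_ : 648 * M / 10000 = (648 / 10000) * M); last by field.
    rewrite ler_pM2r//.
    have : eps * (M * rho) <= eps * 6 by rewrite ler_wpM2l.
    exact: small_product.
  rewrite -(ler_pM2r p2) mulrBl.
  have wM : 0 <= enorm w * M * (pi *+ 2) by rewrite !mulr_ge0// ltW.
  have F1 : enorm w * (192 * M / 1000) * (pi *+ 2)
    = 192 / 1000 * (enorm w * M * (pi *+ 2)) by field.
  have F2 : enorm w * (648 * M / 10000) * (pi *+ 2)
    = 648 / 10000 * (enorm w * M * (pi *+ 2)) by field.
  have F3 : enorm w * (M / 2) * (pi *+ 2) = (enorm w * M * (pi *+ 2)) / 2.
    by field.
  rewrite F3; rewrite F2 in Q; rewrite F1 in E3'.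
  exact: mean_comparison E1 E2 E3' Q wM.
apply: half_le diff; have sM' : enorm ('D_e1 h zs) = M := sM.
by have := enormD ('D_e1 h zs - 'D_e1 h z) ('D_e1 h z); rewrite subrK sM'.
Qed.

End Bubble.
End HolomorphicDisc.

(** * Subharmonicity of u along a disc *)

Section CircleLaplLe.
Context {R : realType}.
Local Notation plane := 'cV[R]_(1 + 1).

Lemma circle_lapl_ge_le (f : plane -> R) z L L' : L' <= L ->
  circle_lapl_ge f z L -> circle_lapl_ge f z L'.
Proof.
move=> LL' fL eta eta0; have [r0 r00 H] := fL eta eta0; exists r0 => // r rr.
by apply: le_trans (H r rr); rewrite ler_wpM2r ?sqr_ge0// lerD2r.
Qed.

Lemma circle_lapl_geZ (f : plane -> R) z L B : 0 < B -> continuous f ->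
  circle_lapl_ge f z L -> circle_lapl_ge (fun z => B * f z) z (B * L).
Proof.
move=> B0 fc fL eta eta0.
have [r0 r00 H] := fL _ (divr_gt0 eta0 B0); exists r0 => // r rr.
rewrite cintZ; last by move=> t; apply: continuous_along; exact: fc.
rewrite -mulrA -mulrBr (_ : B * L - eta = B * (L - eta / B)); last first.
  by field; rewrite gt_eqF.
by rewrite -mulrA ler_pM2l// H.
Qed.

End CircleLaplLe.

Section Composition.
Context {R : realType} {n : nat}.
Local Notation plane := 'cV[R]_(1 + 1).
Variables (D : set 'cV[R]_(n + n)) (J : 'cV[R]_(n + n) -> 'M[R]_(n + n)).
Variables (u : 'cV[R]_(n + n) -> R) (h : plane -> 'cV[R]_(n + n)).
Hypotheses (oD : open D) (Jac : almost_complex D J) (J1 : C1_upto D J).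
Hypotheses (u2 : C2_upto D u) (hol : Jholomorphic D J h).

Let hD z : Delta z -> D (h z). Proof. by case: hol => + _ _; exact. Qed.
Let h1 : C1_on Delta h. Proof. by case: hol. Qed.
Let ud y : D y -> differentiable u y. Proof. by case: u2 => -[+ _ _] _; exact. Qed.
Let duc y v : D y -> {for y, continuous ('D_v u)}.
Proof. by case: u2 => -[_ _ /(_ v) H] _ Dy; exact: (cont_upto_continuous oD H Dy). Qed.
Let hc z : Delta z -> {for z, continuous h}.
Proof. by move=> Dz; apply: differentiable_continuous; exact: h1.1. Qed.

Lemma derive_comp (W : normedModType R) (f : 'cV[R]_(n + n) -> W) z v :
  Delta z -> differentiable f (h z) ->
  'D_v (f \o h) z = 'D_('D_v h z) f (h z).
Proof.
move=> Dz fz; have hz := h1.1 z Dz.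
have fhz : differentiable (f \o h) z by exact: differentiable_comp.
have -> := @deriveE _ _ _ (f \o h) z v fhz.
rewrite (diff_comp hz fz) /=.
by rewrite (@deriveE _ _ _ f (h z) _ fz) (@deriveE _ _ _ h z v hz).
Qed.

Lemma comp_C1_on : C1_on Delta (u \o h).
Proof.
split=> [z Dz|v z Dz].
  by apply: differentiable_comp; [exact: h1.1|apply/ud/hD].
apply: (continuous_open_eq Delta_open Dz
  (f := fun z => \sum_k 'D_v h z k 0 * 'D_(delta_mx k 0) u (h z))).
  move=> y Dy; rewrite derive_comp//; last exact/ud/hD.
  by rewrite (derive_coordE _ (ud (hD Dy))).
apply: continuous_sumr => k; apply: continuousM.
  by apply: continuous_entry; exact: h1.2.
exact: (continuous_comp (hc Dz) (duc (hD Dz))).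
Qed.

(** Since h is J-holomorphic, d^c (u o h) is the pull-back of d^c u, namely the
    form sum_k (dc_coef k o h) dh_k, to which circle_lapl_stokes applies; its
    exterior derivative is the Levi form evaluated on the derivative of h. *)
Lemma comp_circle_lapl z : Delta z ->
  circle_lapl_ge (u \o h) z (pi / 2 * levi J u (h z) ('D_e1 h z)).
Proof.
move=> Dz.
have bd k y : Delta y -> differentiable (dc_coef J u k) (h y).
  by move=> Dy; apply: (dc_coef_differentiable J1 u2); exact: hD.
have Hd k y v : Delta y -> 'D_v (fun z => h z k 0) y = 'D_v h y k 0.
  by move=> Dy; rewrite derive_entry//; apply: diff_derivable; exact: h1.1.
have Hdiff k y : Delta y -> differentiable (fun z => h z k 0 : R) y.
  by move=> Dy; apply: differentiable_entry; exact: h1.1.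
have H1 k : C1_on Delta (fun z => h z k 0 : R).
  split; first exact: Hdiff.
  move=> v y Dy; apply: (continuous_open_eq Delta_open Dy (f := fun z => 'D_v h z k 0)).
    by move=> x Dx; rewrite Hd.
  by apply: continuous_entry; exact: h1.2.
have dphi y t : Delta y -> 'd (u \o h) y (cis t) =
    \sum_k (dc_coef J u k \o h) y * 'd (fun z => h z k 0 : R) y (cisd t).
  move=> Dy; have hy := h1.1 y Dy; have uy := ud (hD Dy).
  rewrite (diff_comp hy uy) /= (diff_cis_cisd Jac hol)//.
  have := dcE J u2 ('d h y (cisd t)) (hD Dy).
  rewrite /dc -linearN => ->; apply: eq_bigr => k _; congr (_ * _).
  rewrite -(@deriveE _ _ _ h y (cisd t) hy).
  by rewrite -(@deriveE _ _ _ (fun z => h z k 0 : R) y (cisd t) (Hdiff k y Dy)) Hd.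
have := circle_lapl_stokes Delta_open Dz comp_C1_on
  (b := fun k => dc_coef J u k \o h) (H := fun k z => h z k 0)
  _ _ H1 dphi.
rewrite (_ : \sum_k _ = levi J u (h z) ('D_e1 h z)).
  apply.
  - move=> k y Dy; apply: differentiable_continuous.
    by apply: differentiable_comp; [exact: h1.1|exact: bd].
  - by move=> k; apply: differentiable_comp; [exact: h1.1|exact: bd].
rewrite (leviE oD J1 u2); last exact: hD.
apply: eq_bigr => k _.
rewrite (derive_comp e1 Dz (bd k z Dz)) (derive_comp e2 Dz (bd k z Dz)).
rewrite (Hd k z e1 Dz) (Hd k z e2 Dz).
have -> : 'D_e2 h z = J (h z) *m 'D_e1 h z by exact: (derive_e2 hol Dz).
by [].
Qed.

End Composition.

(** * The main estimate *)

Section BarrierArithmetic.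
Context {R : realFieldType}.

Lemma barrier_drop (x a : R) : 0 < x -> x <= 1 -> 0 <= a -> a <= 1 / 16 ->
  x / 8 <= x / (x + a) - x / (x + 1 / 4).
Proof.
move=> x0 x1 a0 a1.
have xa : 0 < x + a by lra.
have xb : 0 < x + 1 / 4 by lra.
rewrite -mulrBr ler_pM2l//.
have invB (S T : R) : S != 0 -> T != 0 -> S^-1 - T^-1 = (T - S) / (S * T).
  by move=> S0 T0; field; rewrite S0 T0.
rewrite invB ?gt_eqF// opprD addrACA subrr add0r.
have -> : 8^-1 = 1 / 8 :> R by rewrite div1r.
rewrite ler_pdivlMr ?mulr_gt0//.
have : (x + a) * (x + 1 / 4) <= (17 / 16) * (5 / 4).
  by apply: ler_pM; [exact: ltW|exact: ltW|lra|lra].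
by lra.
Qed.

(** The coefficient k s^2 / 8 of the barrier is half of what would make the
    negative part of its Laplacian, at most 4 / s^2, cancel the contribution k
    of the Levi form on the disc of radius s; outside this disc the barrier
    itself is strictly subharmonic. *)
Lemma barrier_lapl_gt0 (p k l s A : R) : 0 < p -> 0 < k -> 0 < s -> 0 <= A ->
  0 <= l -> (A <= s ^+ 2 -> k <= l) ->
  0 < p / 2 * l + k * s ^+ 2 / 8 *
      (2 * p * s ^+ 2 * (A - s ^+ 2) / (s ^+ 2 + A) ^+ 3).
Proof.
move=> p0 k0 s0 A0 l0 kl.
have x0 : 0 < s ^+ 2 by rewrite exprn_gt0.
move: (s ^+ 2) x0 kl => x x0 kl.
have S0 : 0 < x + A by lra.
have c0 : 0 < k * x / 8 * (2 * p * x) by rewrite !mulr_gt0.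
have S3 : 0 < (x + A) ^+ 3 by rewrite exprn_gt0.
have [Ax|xA] := leP A x.
  have kl' := kl Ax.
  have E : (A - x) / (x + A) ^+ 3 >= - x / x ^+ 3.
    have x3 : 0 < x ^+ 3 by rewrite exprn_gt0.
    rewrite -subr_ge0 mulNr opprK.
    have -> : (A - x) / (x + A) ^+ 3 + x / x ^+ 3
      = (A * (4 * x ^+ 2 + 3 * x * A + A ^+ 2)) / (x ^+ 2 * (x + A) ^+ 3).
      by field; rewrite !gt_eqF.
    rewrite divr_ge0 ?mulr_ge0 ?exprn_ge0 ?(ltW x0) ?(ltW S0)//.
    by rewrite !addr_ge0 ?mulr_ge0 ?exprn_ge0 ?(ltW x0).
  have : k * x / 8 * (2 * p * x) * (- x / x ^+ 3)
       <= k * x / 8 * (2 * p * x) * ((A - x) / (x + A) ^+ 3) by rewrite ler_pM2l.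
  have -> : k * x / 8 * (2 * p * x) * (- x / x ^+ 3) = - (p * k / 4).
    by field; rewrite gt_eqF.
  have -> : k * x / 8 * (2 * p * x) * ((A - x) / (x + A) ^+ 3)
    = k * x / 8 * (2 * p * x * (A - x) / (x + A) ^+ 3) by rewrite !mulrA.
  have : p / 2 * k <= p / 2 * l by rewrite ler_pM2l// divr_gt0.
  have : 0 < p * k by rewrite mulr_gt0.
  by move=> ? ? ?; lra.
apply: ltr_wpDl; first by rewrite mulr_ge0// divr_ge0// ltW.
have Ax : 0 < A - x by rewrite subr_gt0.
by rewrite mulr_gt0 ?divr_gt0 ?mulr_gt0.
Qed.

Lemma quarter_lt1 (x : R) : x <= 1 / 4 -> x < 1.
Proof. by lra. Qed.

Lemma half_quarter_lt1 (x y : R) : x <= 1 / 2 -> y <= 1 / 4 -> x + y < 1.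
Proof. by lra. Qed.

Lemma bubble_radius (a b c rho : R) : rho = (1 / 4 - b) / 2 ->
  c <= a + b -> a < rho -> rho <= 1 / 4 - c.
Proof. by lra. Qed.

Lemma bubble_small (b rho : R) : rho = (1 / 4 - b) / 2 -> 0 <= b -> rho <= 1 / 8.
Proof. by lra. Qed.

Lemma bubble_speed_ratio (x y M : R) : x / 16 <= 4 * y * M -> x <= 64 * y * M.
Proof. by rewrite -!mulrA; move: (y * M) => k; lra. Qed.

Lemma barrier_conclude (v a b c : R) : v + a <= b -> c <= a - b -> c <= - v.
Proof. by lra. Qed.

Lemma le_eighth (x : R) : x <= 1 / 8 -> x / 1000 <= 1.
Proof. by lra. Qed.

Lemma le_half_of_quarter (x : R) : x <= 1 / 4 -> x <= 1 / 2.
Proof. by lra. Qed.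

End BarrierArithmetic.

Section Main.
Context {R : realType} {n : nat}.
Local Notation plane := 'cV[R]_(1 + 1).
Variables (D : set 'cV[R]_(n + n)) (J : 'cV[R]_(n + n) -> 'M[R]_(n + n)).
Variables (u : 'cV[R]_(n + n) -> R) (h : plane -> 'cV[R]_(n + n)) (eps : R).
Hypotheses (oD : open D) (Jac : almost_complex D J) (J1 : C1_upto D J).
Hypotheses (u2 : C2_upto D u) (hol : Jholomorphic D J h).
Hypotheses (u0 : forall x, D x -> u x < 0) (psh : strictly_psh D J u).
Hypotheses (eps0 : 0 <= eps) (eps_small : eps * 10000 <= 1).
Hypothesis Jle2 : forall x v, D x -> enorm (J x *m v) <= 2 * enorm v.
Hypothesis dJle : forall x X v, D x ->
  enorm ('D_X J x *m v) <= eps * enorm X * enorm v.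
Hypothesis D1 : forall x, D x -> enorm x <= 1.

Let Jdiff x : D x -> differentiable J x. Proof. by case: J1 => + _ _; exact. Qed.
Let hD z : Delta z -> D (h z). Proof. by case: hol => + _ _; exact. Qed.
Let h1 : C1_on Delta h. Proof. by case: hol. Qed.

Lemma speed_continuous z : Delta z -> {for z, continuous (speed h)}.
Proof.
move=> Dz; exact: (continuous_comp (h1.2 e1 z Dz) (@enorm_continuous _ _ _)).
Qed.

(** The point zs maximizes (1 / 4 - |z|)^2 speed(z) on the disc of radius 1 / 4,
    and rho is half of its distance to the boundary circle.  The exponent 2
    makes the speed at 0 at most of order rho^2 M, which compensates for the
    factor s^2 = (rho / 1000)^2 lost by the barrier. *)
Lemma exists_bubble : 0 < speed h 0 -> exists zs rho M,
  [/\ 0 < rho <= 1 / 8 /\ 0 < M, enorm zs <= 1 / 4,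
      speed h 0 <= 64 * rho ^+ 2 * M, disc zs rho `<=` @Delta R
    & (forall z, disc zs rho z -> speed h z <= 4 * M) /\ speed h zs = M].
Proof.
move=> s0.
pose K := [set z : plane | enorm (z - 0) <= 1 / 4].
pose g z := (1 / 4 - enorm z) ^+ 2 * speed h z.
have KD (z : plane) : enorm z <= 1 / 4 -> Delta z.
  exact: quarter_lt1.
have gc : {within K, continuous g}.
  apply: continuous_in_subspaceT => z /set_mem; rewrite /K/= subr0 => zK.
  have c1 : {for z, continuous (fun z : plane => (1 / 4 - enorm z) ^+ 2)}.
    apply: continuous_sqr; apply: continuousB; first exact: cst_continuous.
    exact: enorm_continuous.
  exact: (continuousM c1 (speed_continuous (KD z zK))).
have K0 : K 0 by rewrite /K/= subrr enorm0.
have [zs /set_mem] := compact_EVT_max (ex_intro K 0 K0) (@closed_disc_compact _ 0 (1 / 4)) gc.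
rewrite /K/= subr0 => zsK gmax.
have g0 : g 0 = speed h 0 / 16 by rewrite /g enorm0; field.
have gmax0 : speed h 0 / 16 <= g zs by rewrite -g0; apply: gmax; rewrite inE.
pose rho := (1 / 4 - enorm zs) / 2.
have gzs : g zs = 4 * rho ^+ 2 * speed h zs by rewrite /g /rho; field.
have nzs := enorm_ge0 zs.
have rho_ge0 : 0 <= rho by rewrite divr_ge0// subr_ge0.
have gp : 0 < 4 * rho ^+ 2 * speed h zs
  by rewrite -gzs; apply: lt_le_trans gmax0; rewrite divr_gt0.
have sz := enorm_ge0 ('D_e1 h zs).
have rho0 : 0 < rho.
  rewrite lt_def rho_ge0 andbT; apply: contraTneq gp => ->.
  by rewrite expr0n/= mulr0 mul0r ltxx.
have M0 : 0 < speed h zs.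
  rewrite lt_def sz andbT; apply: contraTneq gp => ->.
  by rewrite mulr0 ltxx.
have dz z : disc zs rho z -> rho <= 1 / 4 - enorm z.
  apply: bubble_radius; first by [].
  by rewrite -{1}[z](subrK zs) enormD.
exists zs, rho, (speed h zs); split => //.
- by rewrite rho0 M0; split => //=; apply: bubble_small nzs.
- by apply: bubble_speed_ratio; rewrite -gzs.
- move=> z /dz z14; apply: KD.
  by rewrite -subr_ge0; exact: le_trans z14.
split=> // z /dz z14.
have z14' : 0 <= 1 / 4 - enorm z by exact: le_trans z14.
have : g z <= g zs by apply: gmax; rewrite inE/= subr0 -subr_ge0.
rewrite gzs /g => gg.
have : rho ^+ 2 * speed h z <= (1 / 4 - enorm z) ^+ 2 * speed h z.
  by rewrite ler_wpM2r ?enorm_ge0// lerXn2r ?nnegrE.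
move=> /le_trans/(_ gg).
rewrite (_ : 4 * rho ^+ 2 * speed h zs = rho ^+ 2 * (4 * speed h zs)); last ring.
by rewrite ler_pM2l ?exprn_gt0.
Qed.

(** Near the bubbling point the Laplacian of u o h is at least
    lambda0 (M / 2)^2, so that the sum of u o h and of B times the barrier is
    strictly subharmonic on the disc of radius 1 / 2 around zs.  Comparing its
    value at 0 with its values on the boundary circle yields
    - u (h 0) >= B s^2 / 8. *)
Lemma speed_bound :
  lambda0 D J u * speed h 0 ^+ 2 <= (1024 * 1000 ^+ 2) ^+ 2 * - u (h 0).
Proof.
(* (64 rho^2 M)^2 is compared with B s^2 / 8 = lambda0 M^2 rho^4 / (256 * 1000^4). *)
have [K KE] : exists K : R, K = (1024 * 1000 ^+ 2) ^+ 2 by eexists.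
have K0 : 0 < K.
  rewrite KE; apply: exprn_gt0; apply: mulr_gt0; first by rewrite ltr0n.
  by apply: exprn_gt0; rewrite ltr0n.
rewrite -KE.
have D0 : @Delta R 0 by rewrite /Delta /eball/= enorm0.
have uh0 := u0 (hD D0).
have lam : 0 < lambda0 D J u := psh.
have [s0|s0] := leP (speed h 0) 0.
  have -> : speed h 0 = 0 by apply/eqP; rewrite eq_le s0 enorm_ge0.
  by rewrite expr2 mul0r mulr0 mulr_ge0 ?oppr_ge0 ?ltW.
have [zs [rho [M [[/andP[rho0 rho8] M0] zs4 s0M dD [s4M sM]]]]] := exists_bubble s0.
have low := bubble_speed eps0 Jac Jdiff Jle2 dJle hol D1 rho0 M0 dD s4M sM eps_small.
pose s := rho / 1000.
pose kap := lambda0 D J u * (M / 2) ^+ 2.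
pose B := kap * s ^+ 2 / 8.
have k0 : 0 < 1000 :> R by rewrite ltr0n.
have sp : 0 < s := divr_gt0 rho0 k0.
have kap0 : 0 < kap by rewrite mulr_gt0// exprn_gt0// divr_gt0.
have B0 : 0 < B by rewrite divr_gt0// mulr_gt0// exprn_gt0.
have Dball (z : plane) : enorm (z - zs) <= 1 / 2 -> Delta z.
  move=> zd; rewrite /Delta /eball/= -[z](subrK zs) (le_lt_trans (enormD _ _))//.
  exact: half_quarter_lt1.
have phic z : Delta z -> {for z, continuous (u \o h)}.
  by move=> Dz; apply: differentiable_continuous; apply: (comp_C1_on oD u2 hol).1.
have barc := @barrier_continuous _ s zs sp.
have Bbarc : continuous (fun z => B * barrier s zs z).
  by move=> z; exact: (continuousM (@cst_continuous _ _ B z) (barc z)).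
pose psi z := (u \o h) z + B * barrier s zs z.
have psi_le : forall z, enorm (z - zs) <= 1 / 2 ->
    psi z <= B * (s ^+ 2 / (s ^+ 2 + 1 / 4)).
  apply: (@circle_max_principle _ psi zs (1 / 2)); first by rewrite divr_gt0.
  - by move=> z /Dball Dz; exact: (continuousD (phic z Dz) (Bbarc z)).
  - move=> z zd; have Dz := Dball z (ltW zd).
    exists (pi / 2 * (lambda0 D J u * speed h z ^+ 2) + B *
     (2 * pi * s ^+ 2 * (enorm (z - zs) ^+ 2 - s ^+ 2)
      / (s ^+ 2 + enorm (z - zs) ^+ 2) ^+ 3)).
      apply: barrier_lapl_gt0; rewrite ?pi_gt0 ?sqr_ge0//.
        by rewrite mulr_ge0 ?sqr_ge0// ltW.
      move=> zs_s; have spz : M / 2 <= speed h z.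
        apply: low; rewrite -/s.
        by rewrite -(ler_pXn2r (n := 2))// nnegrE ?enorm_ge0// ltW.
      apply: ler_wpM2l; first exact: ltW.
      have M20 : 0 <= M / 2 by rewrite ltW// divr_gt0.
      have spz0 : 0 <= speed h z := enorm_ge0 _.
      by apply: lerXn2r spz; rewrite nnegrE.
    have [rz rz0 Hrz] := near_disc (near_open Delta_open Dz (fun y Dy => Dy)).
    apply: (circle_lapl_geD rz0).
    + by move=> y /Hrz; exact: phic.
    + by move=> y _; exact: Bbarc.
    + apply: circle_lapl_ge_le (comp_circle_lapl oD Jac J1 u2 hol Dz).
      rewrite ler_pM2l ?divr_gt0 ?pi_gt0//.
      by apply: (levi_ge oD J1 u2) => //; exact: hD.
    + by apply: circle_lapl_geZ => //; exact: barrier_lapl.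
  - move=> z zd; have Dz : Delta z by apply: Dball; rewrite zd.
    rewrite /psi /barrier zd /=.
    have -> : (1 / 2) ^+ 2 = 1 / 4 :> R by field.
    by rewrite gerDr; exact: ltW (u0 (hD Dz)).
have /psi_le : enorm (0 - zs) <= 1 / 2 by rewrite sub0r enormN; exact: le_half_of_quarter.
rewrite /psi /barrier sub0r enormN /= => psi0.
have zs2 : enorm zs ^+ 2 <= 1 / 16.
  have -> : 1 / 16 = (1 / 4) ^+ 2 :> R by field.
  by rewrite lerXn2r ?nnegrE ?enorm_ge0//.
have s1 : s ^+ 2 <= 1.
  have sle1 : s <= 1 by exact: le_eighth.
  by apply: exprn_ile1 => //; exact: ltW.
have drop := barrier_drop (exprn_gt0 2 sp) s1 (sqr_ge0 _) zs2.
have uB : B * (s ^+ 2 / 8) <= - u (h 0).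
  have : B * (s ^+ 2 / 8)
      <= B * (s ^+ 2 / (s ^+ 2 + enorm zs ^+ 2) - s ^+ 2 / (s ^+ 2 + 1 / 4)).
    by rewrite ler_pM2l.
  rewrite mulrBr; exact: barrier_conclude psi0.
apply: (@le_trans _ _ (K * (B * (s ^+ 2 / 8)))); last first.
  by rewrite ler_pM2l.
have -> : K * (B * (s ^+ 2 / 8))
  = lambda0 D J u * (64 * rho ^+ 2 * M) ^+ 2.
  by rewrite KE /B /kap /s; field.
by rewrite ler_pM2l// lerXn2r ?nnegrE ?enorm_ge0// ltW// (lt_le_trans s0).
Qed.

End Main.

Section StandardStructure.
Context {R : realType} {n : nat}.

Lemma enorm_Jst (v : 'cV[R]_(n + n)) : enorm (Jst R n *m v) = enorm v.
Proof.
apply/eqP; rewrite -(eqrXn2 (n := 2)) ?enorm_ge0// !enorm_sqr.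
rewrite dotp_mulmx mulmxA (_ : (Jst R n)^T *m Jst R n = 1%:M) ?mul1mx//.
rewrite /Jst tr_block_mx mulmx_block !trmx0 !mul0mx !mulmx0 !add0r !addr0.
have tN : (- 1%:M : 'M[R]_n)^T = - 1%:M by rewrite linearN /= trmx1.
rewrite tN trmx1 mul1mx mulNmx mulmxN opprK mulmx1.
by rewrite -scalar_mx_block.
Qed.

Variables (D : set 'cV[R]_(n + n)) (J : 'cV[R]_(n + n) -> 'M[R]_(n + n)).
Hypotheses (oD : open D) (J1 : C1_upto D J).

Lemma C1_upto_subJst : C1_upto D (fun x => (J x - Jst R n)%R).
Proof.
case: J1 => Jd [G Gc GJ] dJ; split.
- by move=> x Dx; apply: differentiableB; [exact: Jd|exact: differentiable_cst].
- exists (fun x => G x - Jst R n); last by move=> x Dx; rewrite GJ.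
  by move=> x; apply: cvgB; [exact: Gc|exact: cvg_cst].
- move=> v; have [G' G'c G'J] := dJ v; exists G' => // x Dx.
  rewrite G'J//.
  have JB := is_deriveB (derivableP (@diff_derivable _ _ _ J x v (Jd x Dx)))
     (is_derive_cst (Jst R n) x v).
  by case: JB => _; rewrite subr0.
Qed.

Lemma C1norm_bounds eps x : (C1norm D (fun x => (J x - Jst R n)%R) <= eps%:E)%E ->
  D x -> (forall v, enorm (J x *m v) <= (1 + eps) * enorm v) /\
    forall X v, enorm ('D_X J x *m v) <= eps * enorm X * enorm v.
Proof.
move=> Jeps Dx.
have N1 := C1norm_ge oD Dx C1_upto_subJst Jeps.
have [Jd _ _] := J1; have [Bd _ _] := C1_upto_subJst.
split=> [v|X v].
  have -> : J x *m v = Jst R n *m v + (J x - Jst R n) *m v.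
    by rewrite -mulmxDl addrC subrK.
  rewrite (le_trans (enormD _ _))// enorm_Jst mulrDl mul1r lerD2l.
  rewrite (le_trans (enorm_mulmx _ _))// ler_wpM2r ?enorm_ge0//.
  by apply: le_trans N1; rewrite /norm1_at lerDl sqrtr_ge0.
have JB := is_deriveB (derivableP (@diff_derivable _ _ _ J x X (Jd x Dx)))
     (is_derive_cst (Jst R n) x X).
have -> : 'D_X J x = 'D_X (fun x => J x - Jst R n) x.
  by case: JB => _; rewrite subr0.
rewrite (le_trans (derive_mulmx_le _ _ (Bd x Dx)))//.
by rewrite -!mulrA ler_wpM2r ?mulr_ge0 ?enorm_ge0.
Qed.

End StandardStructure.

Theorem proposition1 (R : realType) :
  exists c' eps' : R, [/\ 0 < c', 0 < eps' &
    forall (n : nat) (D : set 'cV[R]_(n + n))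
           (J : 'cV[R]_(n + n) -> 'M[R]_(n + n)) (u : 'cV[R]_(n + n) -> R),
      is_domain D ->
      D `<=` @eball R (n + n) ->
      almost_complex D J ->
      C1_upto D J ->
      (forall x, D x -> u x < 0) ->
      C2_upto D u ->
      strictly_psh D J u ->
      (C1norm D (fun x => (J x - Jst R n)%R) <= eps'%:E)%E ->
      forall t : R, (forall x, D x -> enorm x <= t) ->
      forall p v : 'cV[R]_(n + n), D p ->
        ((c' * expR (- 2 * t) * Num.sqrt (lambda0 D J u) *
          (enorm v / Num.sqrt `|u p|))%R%:E <= Kobayashi D J p v)%E].
Proof.
have ten : 0 < 10000 :> R by rewrite ltr0n.
have [C CE] : exists C : R, C = 1024 * 1000 ^+ 2 by eexists.
have C0 : 0 < C.
  rewrite CE; apply: mulr_gt0; first by rewrite ltr0n.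
  by apply: exprn_gt0; rewrite ltr0n.
exists (C^-1), (10000^-1); split; [by rewrite invr_gt0|by rewrite invr_gt0|].
move=> n D J u [_ oD _] Dball Jac J1 u0 u2 psh Jeps t Dt p v Dp.
have eps0 : 0 <= 10000^-1 :> R by rewrite invr_ge0 ltW.
have eps_small : 10000^-1 * 10000 <= 1 :> R by rewrite mulVf ?lexx ?gt_eqF.
have eps1 : 1 + 10000^-1 <= 2 :> R.
  by rewrite [leRHS](_ : 2 = 1 + 1)// lerD2l (invf_le1 ten) ler1n.
have bnd x (Dx : D x) := C1norm_bounds oD J1 Jeps Dx.
have Jle2 x w : D x -> enorm (J x *m w) <= 2 * enorm w.
  move=> Dx; apply: le_trans ((bnd x Dx).1 w) _.
  by rewrite ler_wpM2r ?enorm_ge0.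
have D1 x : D x -> enorm x <= 1 by move=> /Dball/ltW.
apply: le_ereal_inf_tmp => _ [alpha [alpha0 [h [hol h0 dh]]] <-].
rewrite lee_fin.
have := speed_bound oD Jac J1 u2 hol u0 psh eps0 eps_small Jle2
  (fun x X w Dx => (bnd x Dx).2 X w) D1.
have -> : speed h 0 = enorm v / alpha.
  by rewrite /speed e1.unlock dh enormZ gtr0_norm ?invr_gt0// mulrC.
rewrite h0 -CE => bound.
have up := u0 p Dp.
have aup : 0 < Num.sqrt `|u p| by rewrite sqrtr_gt0 normr_gt0 lt_eqF.
have lam : 0 < lambda0 D J u := psh.
have key : Num.sqrt (lambda0 D J u) * (enorm v / alpha) <= C * Num.sqrt `|u p|.
  have va : 0 <= enorm v / alpha.
    by apply: divr_ge0; [exact: enorm_ge0|exact: ltW].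
  have lhs0 : 0 <= Num.sqrt (lambda0 D J u) * (enorm v / alpha).
    by apply: mulr_ge0 va; exact: sqrtr_ge0.
  have rhs0 : 0 <= C * Num.sqrt `|u p|.
    by apply: mulr_ge0; [exact: ltW|exact: sqrtr_ge0].
  rewrite -(ler_pXn2r (n := 2))//.
  rewrite [leLHS]exprMn [leRHS]exprMn (sqr_sqrtr (ltW lam)).
  by rewrite (sqr_sqrtr (normr_ge0 _)) ltr0_norm.
have t0 : 0 <= t by apply: le_trans (enorm_ge0 p) (Dt p Dp).
have et : expR (- 2 * t) <= 1.
  by rewrite -expR0 ler_expR mulNr oppr_le0 mulr_ge0.
apply: (@le_trans _ _ (C^-1 * Num.sqrt (lambda0 D J u) * (enorm v / Num.sqrt `|u p|))).
  apply: ler_wpM2r; first by apply: divr_ge0; [exact: enorm_ge0|exact: sqrtr_ge0].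
  apply: ler_wpM2r; first exact: sqrtr_ge0.
  by rewrite ler_piMr// invr_ge0 ltW.
have -> : C^-1 * Num.sqrt (lambda0 D J u) * (enorm v / Num.sqrt `|u p|)
  = (Num.sqrt (lambda0 D J u) * (enorm v / alpha)) * alpha / (C * Num.sqrt `|u p|).
  by field; rewrite !gt_eqF.
rewrite ler_pdivrMr; last exact: mulr_gt0.
by rewrite [leRHS]mulrC ler_pM2r.
Qed.
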